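(* Let $t_0<t_1$, $x_0\in\mathbb{R}^n$, $0<\alpha\le 1$, $\beta>0$, let $L=L(t,x,y)$ be a real-valued function of $(t,x,y)\in[t_0,t_1]\times\mathbb{R}^n\times\mathbb{R}^n$ and $l:\mathbb{R}^n\to\mathbb{R}$. Let $x^0$ deliver a weak local minimum in the problem $$(P_2)\qquad J(x(\cdot))=\int_{t_0}^{t_1}(t_1-t)^{\beta-1}L\big(t,x(t),({}^{c}D_{t_0+}^{\alpha}x)(t)\big)\,dt+l(x(t_1)),\qquad x(t_0)=x_0,$$ in the space $C^{\alpha}([t_0,t_1],\mathbb{R}^n)$. Assume that $L,L_x,L_y$ are continuous in some neighborhood of the graph $\{(t,x^0(t),({}^{c}D_{t_0+}^{\alpha}x^0)(t)) : t\in[t_0,t_1]\}$ and that $l$ is continuously differentiable in a neighborhood of the point $x^0(t_1)$. Write $L_x(t)=L_x(t,x^0(t),({}^{c}D_{t_0+}^{\alpha}x^0)(t))$, $L_y(t)=L_y(t,x^0(t),({}^{c}D_{t_0+}^{\alpha}x^0)(t))$, $b(t)=(t_1-t)^{\beta-1}L_x(t)$, and let $l_{x_1}$ be the gradient of $l$ at $x^0(t_1)$. Then: 1) if $0<\alpha<\beta$, then $$(t_1-t)^{1-\alpha}(I_{t_1-}^{\alpha}b)(t)+(t_1-t)^{\beta-\alpha}L_y(t)=0,\quad t\in[t_0,t_1],\qquad x^0(t_0)=x_0,\qquad l_{x_1}=0;$$ 2) if $0<\beta\le\alpha\le1$, then $$(t_1-t)^{1-\beta}(I_{t_1-}^{\alpha}b)(t)+L_y(t)+l_{x_1}\frac{(t_1-t)^{\alpha-\beta}}{\Gamma(\alpha)}=0,\quad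 t\in[t_0,t_1],\qquad x^0(t_0)=x_0.$$
   Context: For $\alpha>0$: $(I_{t_0+}^{\alpha}\varphi)(t)=\frac{1}{\Gamma(\alpha)}\int_{t_0}^{t}(t-\tau)^{\alpha-1}\varphi(\tau)\,d\tau$ and $(I_{t_1-}^{\alpha}\varphi)(t)=\frac{1}{\Gamma(\alpha)}\int_{t}^{t_1}(\tau-t)^{\alpha-1}\varphi(\tau)\,d\tau$ (left- and right-sided Riemann–Liouville fractional integrals); $I^0_{t_0+}\varphi=\varphi$. For $0<\alpha\le1$ the left-sided Caputo derivative is $({}^{c}D_{t_0+}^{\alpha}\varphi)(t)=\frac{d}{dt}\big(I_{t_0+}^{1-\alpha}(\varphi(\cdot)-\varphi(t_0))\big)(t)$. $C^{\alpha}([t_0,t_1],\mathbb{R}^n)$ is the set of functions of the form $\varphi(t)=\varphi(t_0)+(I_{t_0+}^{\alpha}\psi)(t)$ with $\psi\in C([t_0,t_1],\mathbb{R}^n)$; then ${}^{c}D_{t_0+}^{\alpha}\varphi=\psi$. Its norm is $\|y\|_{C^\alpha}=\max_{t\in[t_0,t_1]}\|y(t)\|+\max_{t\in[t_0,t_1]}\|({}^{c}D_{t_0+}^{\alpha}y)(t)\|$. A function $x\in C^{\alpha}([t_0,t_1],\mathbb{R}^n)$ with $x(t_0)=x_0$ is called admissible. An admissible $x^0$ delivers a weak local minimum in $(P_2)$ if there is $\delta>0$ such that $J(x(\cdot))\ge J(x^0(\cdot))$ for every admissible $x$ with $\|x-x^0\|_{C^\alpha}<\delta$. $L_x,L_y\in\mathbb{R}^n$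 denote the gradients of $L$ in $x$ and $y$. Conventions: neighborhoods of the graph are relative to $[t_0,t_1]\times\mathbb{R}^n\times\mathbb{R}^n$; $0^0=1$; at $t=t_1$ the term containing $I_{t_1-}^{\alpha}b$ has the value $0$ (which is also its limit as $t\to t_1$). *)

(* Defs.v *)
From HB Require Import structures.
From mathcomp Require Import all_boot all_order all_algebra.
From mathcomp Require Import all_classical all_reals all_analysis.

Set Implicit Arguments.
Unset Strict Implicit.
Unset Printing Implicit Defensive.

Import Order.TTheory GRing.Theory Num.Theory.
Import numFieldNormedType.Exports.

Local Open Scope classical_set_scope.
Local Open Scope ring_scope.

Section FractionalCalculus.
Context {R : realType} {n : nat}.
Local Notation mu := (@lebesgue_measure R).
Implicit Types (a t : R) (phi y : R -> 'rV[R]_n).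

Definition Gamma a : R :=
  \int[mu]_(s in `]0, +oo[%classic) (s `^ (a - 1) * expR (- s)).

(* Euclidean norm; the library norm on 'rV[R]_n is the sup norm. *)
Definition enorm (v : 'rV[R]_n) : R := Num.sqrt (\sum_i v 0 i ^+ 2).

(* Integrals of vector-valued functions are taken componentwise. *)
Definition vintegral (D : set R) phi : 'rV[R]_n :=
  \row_i \int[mu]_(s in D) phi s 0 i.

(* Meaningful for a >= 0, with I^0 the identity. *)
Definition RLleft t0 a phi t : 'rV[R]_n :=
  if a == 0 then phi t
  else (Gamma a)^-1 *:
    vintegral `[t0, t]%classic (fun s => (t - s) `^ (a - 1) *: phi s).

(* For a > 0; the value at t = t1 is 0, as the domain is then a singleton. *)
Definition RLright t1 a phi t : 'rV[R]_n :=
  (Gamma a)^-1 *: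
    vintegral `[t, t1]%classic (fun s => (s - t) `^ (a - 1) *: phi s).

(* Derivative of a function on [t0, t1]: one-sided at the end points, and
   independent of the values outside [t0, t1]. *)
Definition deriv_on t0 t1 phi t : 'rV[R]_n :=
  lim ((s - t)^-1 *: (phi s - phi t) @[s --> within `[t0, t1]%classic t^']).

Definition caputo t0 t1 a phi : R -> 'rV[R]_n :=
  deriv_on t0 t1 (RLleft t0 (1 - a) (fun s => phi s - phi t0)).

Definition Calpha t0 t1 a phi : Prop :=
  exists psi : R -> 'rV[R]_n,
    {within `[t0, t1]%classic, continuous psi} /\
    {in `[t0, t1], forall t, phi t = phi t0 + RLleft t0 a psi t}.

(* For y in Calpha both suprema are maxima of continuous functions. *)
Definition Calpha_norm t0 t1 a y : R :=
  sup [set enorm (y t) | t in `[t0, t1]%classic] +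
  sup [set enorm (caputo t0 t1 a y t) | t in `[t0, t1]%classic].

Definition gradient (f : 'rV[R]_n -> R) (x : 'rV[R]_n) : 'rV[R]_n :=
  \row_i 'D_(delta_mx 0 i) f x.

Definition has_gradient (f : 'rV[R]_n -> R) (x : 'rV[R]_n) : Prop :=
  forall i, derivable f x (delta_mx 0 i).

Definition gradx (L : R -> 'rV[R]_n -> 'rV[R]_n -> R) t (x y : 'rV[R]_n) :=
  gradient (fun z => L t z y) x.

Definition grady (L : R -> 'rV[R]_n -> 'rV[R]_n -> R) t (x y : 'rV[R]_n) :=
  gradient (fun z => L t x z) y.

Definition functional_J t0 t1 a (b : R)
    (L : R -> 'rV[R]_n -> 'rV[R]_n -> R) (l : 'rV[R]_n -> R)
    (x : R -> 'rV[R]_n) : R :=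
  (\int[mu]_(t in `[t0, t1]%classic)
     ((t1 - t) `^ (b - 1) * L t (x t) (caputo t0 t1 a x t))) + l (x t1).

Definition admissible t0 t1 a (xi : 'rV[R]_n) (x : R -> 'rV[R]_n) : Prop :=
  Calpha t0 t1 a x /\ x t0 = xi.

Definition weak_local_min t0 t1 a (b : R)
    (L : R -> 'rV[R]_n -> 'rV[R]_n -> R) (l : 'rV[R]_n -> R)
    (xi : 'rV[R]_n) (xm : R -> 'rV[R]_n) : Prop :=
  admissible t0 t1 a xi xm /\
  exists2 delta : R, 0 < delta &
    forall x, admissible t0 t1 a xi x ->
      Calpha_norm t0 t1 a (fun t => x t - xm t) < delta ->
      functional_J t0 t1 a b L l xm <= functional_J t0 t1 a b L l x.

(* L and its gradients in x and y are continuous on a neighborhood, relative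
   to [t0, t1] * R^n * R^n, of the graph of t |-> (x t, y t). *)
Definition C1_near_graph t0 t1
    (L : R -> 'rV[R]_n -> 'rV[R]_n -> R) (x y : R -> 'rV[R]_n) : Prop :=
  exists U : set (R * 'rV[R]_n * 'rV[R]_n),
    let D := U `&` [set p | p.1.1 \in `[t0, t1]] in
    [/\ open U,
        {in `[t0, t1], forall t, U (t, x t, y t)},
        (forall p, D p ->
           has_gradient (fun z => L p.1.1 z p.2) p.1.2 /\
           has_gradient (fun z => L p.1.1 p.1.2 z) p.2) &
        [/\ {within D, continuous (fun p => L p.1.1 p.1.2 p.2)},
            {within D, continuous (fun p => gradx L p.1.1 p.1.2 p.2)} &
            {within D, continuous (fun p => grady L p.1.1 p.1.2 p.2)}]].

Definition C1_near (l : 'rV[R]_n -> R) (x : 'rV[R]_n) : Prop :=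
  \forall z \near x, differentiable l z /\ {for z, continuous (gradient l)}.

End FractionalCalculus.

(* Main.v *)
(* If phi = phi t0 + I^a psi, then I^(1-a) (phi - phi t0) is the primitive of psi,
   because Gamma a * Gamma (1 - a) is the Beta integral B(a, 1 - a); hence the Caputo
   derivative of phi is psi, and varying psi by eps g e_i moves the minimizer by
   eps (I^a g) e_i.

   A one-dimensional mean value theorem in x and in y, uniform over the compact graph,
   gives the first variation; Fubini moves I^a from g to the right-sided integral of
   b = (t1 - t)^(beta-1) L_x. Testing against tent functions g then yields
     I_-^a b + (t1 - t)^(beta-1) L_y + l_x1 (t1 - t)^(a-1) / Gamma a = 0 on [t0, t1[.

   The bound |I_-^a b (t)| <= C (t1 - t)^(a+beta-1) settles what happens at t1. After
   multiplying by (t1 - t)^(1-a), when a < beta every term but l_x1 / Gamma a tends to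
   0, so l_x1 = 0; after multiplying by (t1 - t)^(1-beta), when beta <= a, the equation
   passes to the limit. *)

Require Import Defs.
From mathcomp Require Import all_boot all_order all_algebra.
From mathcomp Require Import all_classical all_reals all_analysis.
From mathcomp Require Import measurable_realfun ring lra.

Set Implicit Arguments.
Unset Strict Implicit.
Unset Printing Implicit Defensive.

Import Order.TTheory GRing.Theory Num.Theory.
Import numFieldNormedType.Exports.

Local Open Scope classical_set_scope.
Local Open Scope ring_scope.

(** Fractional integrals are rewritten as convolutions over the whole line, kernel and function both
    extended by zero. The semigroup law, integration by parts and the continuity estimates then rest
    on affine substitutions, Fubini and one Beta computation. The price is that the kernel and the
    literal power may disagree at one point, since 0 ^ 0 = 1; equality almost everywhere absorbs
    this. Varying along one coordinate vector at a time splits the problem into scalar ones and uses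
    only the partial derivatives that [has_gradient] provides. The obstacle is the end point t1,
    where (t1 - t)^(beta-1) and (t1 - t)^(alpha-1) may both blow up. Orthogonality is therefore
    exploited locally at each t < t1, and whatever is claimed at t1 has to come from a limit or from
    the vanishing of the right-sided integral there. Each of the two multipliers cancels the more
    singular of these powers: for alpha < beta that of the l-term, which is then left alone in the
    limit; for beta <= alpha that of the weight, which leaves L_y and l_x1 coupled. *)

Section AffineSubstitution.
Context {R : realType}.
Local Notation mu := (@lebesgue_measure R).

Lemma measurable_affine (c d : R) : measurable_fun setT (fun x : R => c * x + d).
Proof. by apply: measurable_funD => //; exact: measurable_funM. Qed.

(** The push-forward of Lebesgue measure by the affine map, scaled by |c|, has the right value on
    half-open intervals, so it is Lebesgue measure by uniqueness. Only measurability of [f] enters,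
    which suits the singular kernels below. *)
Lemma ge0_integral_affine (c d : R) (f : R -> \bar R) : c != 0 ->
  measurable_fun setT f -> (forall x, 0 <= f x)%E ->
  (\int[mu]_x f x = `|c|%:E * \int[mu]_x f (c * x + d)%R)%E.
Proof.
move=> c0 mf f0; pose phi := fun x : R => c * x + d.
have mphi : @measurable_fun _ _ (measurableTypeR R) (measurableTypeR R) setT phi.
  exact: measurable_affine.
pose m' : {measure set (measurableTypeR R) -> \bar R} :=
  mscale (NngNum (normr_ge0 c))
    (@pushforward _ _ (measurableTypeR R) (measurableTypeR R) _ mu phi).
pose m := m' mphi.
have mE : forall X, ocitv X -> mu X = m X.
  move=> X [[x y] _ <-];
  change (mu `]x, y] = `|c|%:E * mu (phi @^-1` `]x, y]))%E.
  have [xy|yx] := ltP x y; last first.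
    have -> : `]x, y]%classic = set0 :> set R.
      by rewrite set_itv_ge ?bnd_simp -?leNgt.
    by rewrite preimage_set0 !measure0 mule0.
  move: c0; rewrite neq_lt => /orP[cl0|cg0].
    rewrite (_ : phi @^-1` _ = `[(y - d) / c, (x - d) / c[%classic); last first.
      apply/seteqP; split => z /=; rewrite !in_itv /= /phi ler_ndivrMr//
        ltr_ndivlMr// => /andP[h1 h2]; apply/andP; split; lra.
    rewrite !lebesgue_measure_itv /= !lte_fin xy ltr_ndivrMr// mulfVK ?lt_eqF//.
    rewrite ltrD2r xy -!EFinD -EFinM ltr0_norm//; congr EFin.
    by field; rewrite lt_eqF.
  rewrite (_ : phi @^-1` _ = `](x - d) / c, (y - d) / c]%classic); last first.
    apply/seteqP; split => z /=; rewrite !in_itv /= /phi ler_pdivlMr//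
      ltr_pdivrMr// => /andP[h1 h2]; apply/andP; split; lra.
  rewrite !lebesgue_measure_itv /= !lte_fin xy ltr_pdivrMr// mulfVK ?gt_eqF//.
  rewrite ltrD2r xy -!EFinD -EFinM gtr0_norm//; congr EFin.
  by field; rewrite gt_eqF.
rewrite (@eq_measure_integral _ _ _ _ m); last first.
  by move=> A mA _; exact: lebesgue_measure_unique.
rewrite ge0_integral_mscale//=; congr (_ * _)%E.
by rewrite (ge0_integral_pushforward mphi).
Qed.

Lemma integrable_affine (c d : R) (f : R -> R) : c != 0 ->
  mu.-integrable setT (EFin \o f) ->
  mu.-integrable setT (EFin \o (fun x => f (c * x + d))).
Proof.
move=> c0 /integrableP[/measurable_EFinP mf foo]; apply/integrableP; split.
  by apply/measurable_EFinP; apply: measurableT_comp mf _; exact: measurable_affine.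
move: foo; rewrite (@ge0_integral_affine c d)//=; last first.
  by do 2 apply: measurableT_comp => //.
by rewrite !ltey; apply: contra_neq => ->; rewrite gt0_muley// lte_fin normr_gt0.
Qed.

Lemma Rintegral_affine (c d : R) (f : R -> R) : c != 0 ->
  mu.-integrable setT (EFin \o f) ->
  \int[mu]_x f x = `|c| * \int[mu]_x f (c * x + d).
Proof.
move=> c0 fi; have fi' := integrable_affine d c0 fi.
have mf := measurable_int mu fi.
have mp : measurable_fun setT ((EFin \o f)^\+)%E by exact: measurable_funepos.
have mn : measurable_fun setT ((EFin \o f)^\-)%E by exact: measurable_funeneg.
have Fp := integrable_pos_fin_num measurableT fi'.
have Fn := integrable_neg_fin_num measurableT fi'.
rewrite /Rintegral integralE (ge0_integral_affine d c0 mp)//.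
rewrite (ge0_integral_affine d c0 mn)// [in RHS]integralE.
rewrite (@eq_integral _ _ _ mu setT
  ((EFin \o (fun x => f (c * x + d)%R))^\+)%E (fun x => ((EFin \o f)^\+)%E (c * x + d))); last first.
  by move=> x _; rewrite !funeposE.
rewrite (@eq_integral _ _ _ mu setT
  ((EFin \o (fun x => f (c * x + d)%R))^\-)%E (fun x => ((EFin \o f)^\-)%E (c * x + d))); last first.
  by move=> x _; rewrite !funenegE.
by rewrite -(fineK Fp) -(fineK Fn) -!EFinM -!EFinB /= mulrBr.
Qed.

End AffineSubstitution.

(** * Real-valued integrals over intervals, written over the whole line *)

Section RealIntegrals.
Context {R : realType}.
Local Notation mu := (@lebesgue_measure R).
Local Notation intg D f := (mu.-integrable D (EFin \o (f : R -> R))).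
Implicit Types (f g : R -> R) (I : interval R).

(** An indicator factor, unlike a domain of integration, can be carried through substitutions,
    Fubini and ring identities. *)
Lemma restrict_itvE I f : f \_ [set` I] = (fun x => (x \in I)%:R * f x).
Proof.
apply/funext => x; rewrite patchE; have [h|h] := boolP (x \in I).
  by rewrite mem_set// mul1r.
by rewrite memNset ?mul0r//=; exact/negP.
Qed.

Lemma Rintegral_itvE I f :
  \int[mu]_(x in [set` I]) f x = \int[mu]_x ((x \in I)%:R * f x).
Proof. by rewrite Rintegral_mkcond restrict_itvE. Qed.

Lemma integrable_itvP I f :
  intg [set` I] f <-> intg setT (fun x => (x \in I)%:R * f x).
Proof.
rewrite -restrict_itvE -restrict_EFin.
by rewrite -integrable_mkcond.
Qed.

Lemma measurable_itv_indic I : measurable_fun setT (fun x : R => (x \in I)%:R : R).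
Proof.
rewrite (_ : (fun x : R => _) = \1_[set` I]); first exact: measurable_indic.
by apply/funext => x; rewrite indicE mem_setE.
Qed.

Lemma integrable_measurable D f : intg D f -> measurable_fun D f.
Proof. by move=> h; apply/measurable_EFinP; exact: (measurable_int mu). Qed.

Lemma integrableDr f g D : measurable D -> intg D f -> intg D g ->
  intg D (fun x => f x + g x).
Proof. by move=> mD; exact: (@integrableD _ _ _ mu D mD (EFin \o f) (EFin \o g)). Qed.

Lemma integrableBr f g D : measurable D -> intg D f -> intg D g ->
  intg D (fun x => f x - g x).
Proof. by move=> mD; exact: (@integrableB _ _ _ mu D mD (EFin \o f) (EFin \o g)). Qed.

Lemma integrable_cstM f r D : measurable D -> intg D f -> intg D (fun x => r * f x).
Proof. by move=> mD; exact: (@integrableZl _ _ _ mu D mD r (EFin \o f)). Qed.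

Lemma le_integrable_fun f g D : measurable D -> measurable_fun D f ->
  (forall x, D x -> `|f x| <= g x) -> intg D g -> intg D f.
Proof.
move=> mD mf fg ig; apply: (@le_integrable _ _ _ mu D mD _ (EFin \o g)) => //.
  exact/measurable_EFinP.
by move=> x Dx; rewrite /= lee_fin (le_trans (fg x Dx))// ler_norm.
Qed.

Lemma integrable_bddM f g M D : measurable D -> measurable_fun D f ->
  (forall x, D x -> `|f x| <= M) -> intg D g -> intg D (fun x => f x * g x).
Proof.
move=> mD mf fM ig.
apply: (@le_integrable_fun _ (fun x => M * `|g x|)) => //.
- by apply: measurable_funM => //; exact: integrable_measurable.
- by move=> x Dx; rewrite normrM ler_wpM2r// fM.
- by apply: integrable_cstM => //; exact: (integrable_norm ig).
Qed.

Lemma continuous_bounded_itv (p q : R) f : {within `[p, q], continuous f} ->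
  exists2 M, 0 < M & forall x, x \in `[p, q] -> `|f x| <= M.
Proof.
move=> cf; have /compact_bounded : compact (f @` `[p, q]%classic).
  by apply: continuous_compact => //; exact: segment_compact.
(* Every number above [M] is a bound, hence [M + 1]; the maximum with 1 makes the bound positive, so
   that it may serve as a divisor. *)
move=> [M [_ HM]]; exists (Num.max (M + 1) 1); first by rewrite lt_max ltr01 orbT.
move=> x xpq; have [h|h] := leP (M + 1) 1.
  by apply: (HM 1); [rewrite (lt_le_trans _ h)// ltrDl|exists x].
by apply: (HM (M + 1)); [rewrite ltrDl|exists x].
Qed.

Lemma measurable_continuous_itv (p q : R) f :
  {within `[p, q], continuous f} -> measurable_fun `[p, q] f.
Proof. by move=> cf; exact: subspace_continuous_measurable_fun. Qed.

Lemma measurable_itvM I f : measurable_fun [set` I] f ->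
  measurable_fun setT (fun x => (x \in I)%:R * f x).
Proof.
move=> mf; rewrite -restrict_itvE.
by apply: (iffLR (measurable_restrictT _ _)) => //; exact: measurable_itv.
Qed.

Lemma le_normr_Rintegral_dom f g D : measurable D -> intg D f -> intg D g ->
  (forall x, D x -> `|f x| <= g x) ->
  `|\int[mu]_(x in D) f x| <= \int[mu]_(x in D) g x.
Proof.
move=> mD fi gi fg; apply: (le_trans (le_normr_Rintegral mD fi)).
by apply: le_Rintegral => //; exact: (integrable_norm fi).
Qed.

End RealIntegrals.

(** * The power kernel, and the Gamma function on ]0, 1] *)

Section Kernel.
Context {R : realType}.
Local Notation mu := (@lebesgue_measure R).

Lemma le0_ler_powR (e x y : R) : e <= 0 -> 0 < x -> x <= y -> y `^ e <= x `^ e.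
Proof.
move=> e0 x0 xy; rewrite -[e]opprK !(powRN _ (- e)) lef_pV2 ?posrE ?powR_gt0//.
  by apply: ge0_ler_powR; rewrite ?oppr_ge0// ?nnegrE ltW// (lt_le_trans x0).
exact: lt_le_trans xy.
Qed.

Lemma continuous_powR_gt0 (p x : R) : 0 < x -> {for x, continuous (fun y : R => y `^ p)}.
Proof.
move=> x0; apply: differentiable_continuous; apply/derivable1_diffP.
by apply: derivable_powR; rewrite in_itv /= x0.
Qed.

(* The kernel of the fractional integrals, extended by 0 to u <= 0 so that they
   become convolutions over the whole line. The value 0 at u = 0 differs from
   0 `^ (a - 1) when a = 1, but a single point does not matter. *)
Definition rlker (a u : R) : R := if 0 < u then u `^ (a - 1) else 0.

Lemma rlker_ge0 a u : 0 <= rlker a u.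
Proof. by rewrite /rlker; case: ifP => // _; exact: powR_ge0. Qed.

Lemma rlker_gt0E a u : 0 < u -> rlker a u = u `^ (a - 1).
Proof. by rewrite /rlker => ->. Qed.

Lemma rlker_le0E a u : u <= 0 -> rlker a u = 0.
Proof. by rewrite /rlker ltNge => ->. Qed.

Lemma rlkerM (a c u : R) : 0 < c -> rlker a (c * u) = c `^ (a - 1) * rlker a u.
Proof.
move=> c0; rewrite /rlker pmulr_rgt0//; case: ifPn => u0; last by rewrite mulr0.
by rewrite powRM// ltW.
Qed.

Lemma rlker_nincr (a u v : R) : a <= 1 -> 0 < u -> u <= v -> rlker a v <= rlker a u.
Proof.
move=> a1 u0 uv; rewrite !rlker_gt0E// ?(lt_le_trans u0)//.
by apply: le0_ler_powR => //; rewrite subr_le0.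
Qed.

Lemma measurable_rlker (a : R) : measurable_fun setT (rlker a).
Proof.
rewrite (_ : rlker a = (fun u : R => u `^ (a - 1)) \_ `]0, +oo[%classic).
  apply: (iffLR (measurable_restrictT _ _)) => //.
  by apply: measurable_funTS; exact: measurable_powR.
apply/funext => u; rewrite patchE /rlker; case: ifPn => u0.
  by rewrite mem_set//= in_itv /= u0.
by rewrite memNset//= in_itv /= (negbTE u0).
Qed.

Lemma continuous_rlker (a u : R) : 0 < u -> {for u, continuous (rlker a)}.
Proof.
move=> u0; rewrite /prop_for /continuous_at rlker_gt0E//.
apply: cvg_trans; last exact: continuous_powR_gt0.
apply: near_eq_cvg; near=> y; rewrite rlker_gt0E//.
by near: y; exact: lt_nbhsr.
Unshelve. all: by end_near. Qed.

(** The kernel may be singular at 0, so the fundamental theorem is applied on [c / (n + 2), c] and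
    monotone convergence does the rest. The offset 2 keeps these intervals nondegenerate already for
    n = 0. *)
Lemma integral_rlker0c (a c : R) : 0 < a -> 0 < c ->
  (\int[mu]_(x in `]0%R, c]) (rlker a x)%:E = (c `^ a / a)%:E)%E.
Proof.
move=> a0 c0; pose F (n : nat) : set R := `[c / n.+2%:R, c]%classic.
have cn (n : nat) : 0 < c / n.+2%:R by rewrite divr_gt0.
have cnc (n : nat) : c / n.+2%:R < c.
  by rewrite ltr_pdivrMr// ltr_pMr// ltr1n.
have UF : \bigcup_n F n = `]0, c]%classic.
  apply/seteqP; split => [x [n _] | x] /=; rewrite !in_itv /=.
    by rewrite /F /= in_itv /= => /andP[h ->]; rewrite andbT (lt_le_trans _ h).
  move=> /andP[x0 xc]; have [n _ hn] := near_infty_natSinv_lt (PosNum (divr_gt0 x0 c0)).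
  exists n => //; rewrite /F /= in_itv /= xc andbT.
  have := hn n (leqnn n); rewrite /= ltr_pdivlMr// => h.
  rewrite (le_trans _ (ltW h))// mulrC ler_wpM2r ?(ltW c0)//.
  by rewrite lef_pV2 ?posrE// ler_nat.
have cvg1 := @ge0_nondecreasing_set_cvg_integral _ (measurableTypeR R) _ F (EFin \o rlker a) mu.
have H : (\int[mu]_(x in F n) (rlker a x)%:E @[n --> \oo] -->
          \int[mu]_(x in `]0%R, c]) (rlker a x)%:E)%E.
  rewrite -UF; apply: cvg1.
  - move=> n m nm; apply/subsetPset => x; rewrite /F /= !in_itv /= => /andP[h ->].
    rewrite andbT (le_trans _ h)// ler_wpM2l ?(ltW c0)//.
    by rewrite lef_pV2 ?posrE// ler_nat !ltnS.
  - by move=> i; exact: measurable_itv.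
  - move=> i; apply/measurable_EFinP; apply: measurable_funS (measurable_rlker a) => //.
  - by move=> i x _; rewrite lee_fin rlker_ge0.
have E n : (\int[mu]_(x in F n) (rlker a x)%:E = ((c `^ a - (c / n.+2%:R) `^ a) / a)%:E)%E.
  rewrite (@continuous_FTC2 _ (rlker a) (fun x => x `^ a / a))//.
  - by rewrite -EFinB mulrBl.
  - apply: continuous_in_subspaceT => x /set_mem /=; rewrite in_itv /= => /andP[h1 h2].
    have x0 : 0 < x by exact: lt_le_trans h1.
    exact: continuous_rlker.
  - have ct x : 0 < x -> {for x, continuous (fun x => x `^ a / a)}.
      move=> x0; apply: continuousM; last exact: cvg_cst.
      exact: continuous_powR_gt0.
    split.
    + move=> x; rewrite in_itv /= => /andP[h1 h2].
      apply: derivableM => //.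
      by apply: derivable_powR; rewrite in_itv /= (lt_trans _ h1).
    + by apply: cvg_at_right_filter; exact: ct.
    + by apply: cvg_at_left_filter; exact: ct.
  - move=> x; rewrite in_itv /= => /andP[h1 h2]; have x0 := lt_trans (cn n) h1.
    rewrite derive1Mr; last by apply: derivable_powR; rewrite in_itv /= x0.
    rewrite powR_derive1 ?in_itv /= ?x0// rlker_gt0E//.
    by rewrite mulrAC divff ?gt_eqF// mul1r.
have H2 : (((c `^ a - (c / n.+2%:R) `^ a) / a)%:E @[n --> \oo] --> (c `^ a / a)%:E)%E.
  apply: cvg_EFin; first by near=> n.
  suff : c `^ a - (c / n.+2%:R) `^ a @[n --> \oo] --> c `^ a - 0.
    by rewrite subr0 => h; apply: cvgM => //; exact: cvg_cst.
  apply: cvgB; first exact: cvg_cst.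
  have := powR_cvg0 a0 => /cvg_at_rightP; apply; split => // .
  rewrite -(mulr0 c); apply: cvgM; first exact: cvg_cst.
  by have := @cvg_harmonic R; rewrite -(@cvg_shiftS _ (harmonic : nat -> R)).
rewrite -(cvg_lim _ H)//; under eq_fun do rewrite E.
by apply/cvg_lim.
Unshelve. all: by end_near. Qed.

Lemma rlker_itvE (a c x : R) : (x \in `]-oo, c])%:R * rlker a x =
  (x \in `]0, c])%:R * rlker a x.
Proof.
rewrite !in_itv /=; have [x0|x0] := ltP 0 x; first by [].
by rewrite rlker_le0E// !mulr0.
Qed.

Lemma integral_rlker_le (a c : R) : 0 < a -> 0 < c ->
  (\int[mu]_x ((x \in `]-oo, c])%:R * rlker a x)%:E = (c `^ a / a)%:E)%E.
Proof.
move=> a0 c0; under eq_integral do rewrite rlker_itvE.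
rewrite -integral_rlker0c// [RHS]integral_mkcond restrict_EFin.
by rewrite (@restrict_itvE _ `]0, c]).
Qed.

Lemma integrable_rlker_le (a c : R) : 0 < a ->
  mu.-integrable `]-oo, c]%classic (EFin \o rlker a).
Proof.
move=> a0; pose d := Num.max c 1.
apply: (@integrableS _ _ _ mu `]-oo, d]%classic) => //.
  by move=> x /=; rewrite !in_itv /= => /le_trans; apply; rewrite le_max lexx.
have d0 : 0 < d by rewrite lt_max ltr01 orbT.
apply/(@integrable_itvP _ `]-oo, d]); apply/integrableP; split.
  by apply/measurable_EFinP; apply: measurable_itvM; by apply: measurable_funTS; exact: measurable_rlker.
under eq_integral do rewrite /= ger0_norm ?mulr_ge0 ?rlker_ge0//.
by rewrite integral_rlker_le// ltry.
Qed.

Lemma Rintegral_rlker_le (a c : R) : 0 < a -> 0 <= c ->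
  \int[mu]_(x in `]-oo, c]) rlker a x = c `^ a / a.
Proof.
move=> a0; rewrite le_eqVlt Rintegral_itvE => /predU1P[<-|c0]; last first.
  by rewrite /Rintegral integral_rlker_le.
rewrite powR0 ?gt_eqF// mul0r.
rewrite (@eq_Rintegral _ _ _ _ _ (cst 0)); last first.
  move=> x _; rewrite in_itv /=; have [x0|] := leP x 0; last by rewrite mul0r.
  by rewrite rlker_le0E// mulr0.
by rewrite /Rintegral integral0.
Qed.

Lemma GammaE (a : R) : Gamma a = \int[mu]_x (rlker a x * expR (- x)).
Proof.
rewrite /Gamma Rintegral_itvE; apply: eq_Rintegral => x _; rewrite in_itv /= andbT.
by rewrite /rlker; case: ifPn => x0; rewrite !(mul1r, mul0r).
Qed.

Lemma measurable_expRN : measurable_fun setT (fun x : R => expR (- x)).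
Proof. by apply: measurableT_comp => //; exact: measurable_expR. Qed.

(** Up to 1 the exponential factor is at most 1 on the support of the kernel; beyond 1 the kernel is
    at most 1, because a <= 1, and the exponential density dominates. *)
Lemma integrable_Gamma (a : R) : 0 < a -> a <= 1 ->
  mu.-integrable setT (EFin \o (fun x => rlker a x * expR (- x))).
Proof.
move=> a0 a1.
have mk : measurable_fun setT (fun x => rlker a x * expR (- x)).
  by apply: measurable_funM measurable_expRN; exact: measurable_rlker.
pose g x := (x \in `]-oo, 1])%:R * rlker a x + exponential_pdf 1 x.
apply: (@le_integrable_fun _ _ g) => //.
- move=> x _; rewrite /g ger0_norm; last first.
    by rewrite mulr_ge0 ?expR_ge0 ?rlker_ge0.
  have E0 := @exponential_pdf_ge0 R 1 ler01 x.
  rewrite in_itv /=; have [x1|x1] := leP x 1; rewrite ?mul1r ?mul0r.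
    have [x0|x0] := ltP 0 x; last by rewrite rlker_le0E// mul0r add0r.
    rewrite -[leLHS]addr0 lerD// ler_piMr ?rlker_ge0//.
    by rewrite -expR0 ler_expR oppr_le0 ltW.
  rewrite add0r; have x0 : 0 < x by rewrite (lt_trans _ x1).
  rewrite exponential_pdfE ?(ltW x0)// mul1r mulN1r ler_piMl ?expR_ge0//.
  rewrite rlker_gt0E// -(powRr0 x); apply: ler_powR; rewrite ?(ltW x1)//.
  by rewrite powRr0 subr_le0.
- apply: integrableDr => //; first exact/integrable_itvP/integrable_rlker_le.
  exact: integrable_exponential_pdf.
Qed.

(** Up to 1 the exponential is at least [expR (-1)], and the kernel has integral 1 / a there. *)
Lemma Gamma_gt0 (a : R) : 0 < a -> a <= 1 -> 0 < Gamma a.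
Proof.
move=> a0 a1; rewrite GammaE.
have i1 := integrable_Gamma a0 a1.
have i2 : mu.-integrable `]-oo, 1]%classic (EFin \o (fun x => expR (-1) * rlker a x)).
  by apply: integrable_cstM => //; exact: integrable_rlker_le.
apply: (@lt_le_trans _ _ (\int[mu]_(x in `]-oo, 1%R]) (expR (-1) * rlker a x))).
  rewrite RintegralZl ?Rintegral_rlker_le ?powR1 ?mulr_gt0 ?expR_gt0 ?invr_gt0//.
  exact: integrable_rlker_le.
rewrite Rintegral_itvE; apply: le_Rintegral => //; first exact/integrable_itvP.
move=> x _; rewrite in_itv /=; have [x1|x1] := leP x 1; last first.
  by rewrite mul0r mulr_ge0 ?expR_ge0 ?rlker_ge0.
by rewrite mul1r mulrC ler_wpM2l ?rlker_ge0// ler_expR lerN2.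
Qed.

Lemma Gamma1 : Gamma 1 = 1 :> R.
Proof.
rewrite GammaE /Rintegral.
rewrite (@ae_eq_integral _ _ _ mu setT (EFin \o exponential_pdf 1)) //.
- by rewrite integral_exponential_pdf.
- apply/measurable_EFinP.
  by apply: measurable_funM measurable_expRN; exact: measurable_rlker.
- by apply/measurable_EFinP; exact: measurable_exponential_pdf.
(* The two integrands differ only at 0, where the kernel is 0 by definition and the density is 1. *)
- exists [set 0]; split => //; first exact: lebesgue_measure_set1.
  move=> x /= /not_implyP[_]; apply: contra_notP => x0; congr EFin.
  have [x1|] := ltP 0 x.
    rewrite exponential_pdfE ?(ltW x1)// rlker_gt0E// subrr powRr0.
    by rewrite !mul1r mulN1r.
  rewrite le_eqVlt => /predU1P[//|x1].
  by rewrite lt0_exponential_pdf// rlker_le0E ?(ltW x1)// mul0r.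
Qed.

End Kernel.

(** * Beta integrals and the convolution of two kernels *)

Section Beta.
Context {R : realType}.
Local Notation mu := (@lebesgue_measure R).
Implicit Types (a b p q s t x : R).

Lemma measurable_rlkerB a t : measurable_fun setT (fun s => rlker a (t - s)).
Proof.
by apply: measurableT_comp (measurable_rlker a) _; exact: measurable_funB.
Qed.

Lemma measurable_rlkerBr a t : measurable_fun setT (fun s => rlker a (s - t)).
Proof.
by apply: measurableT_comp (measurable_rlker a) _; exact: measurable_funB.
Qed.

Lemma integrable_rlkerB a p t : 0 < a ->
  mu.-integrable `[p, +oo[%classic (EFin \o (fun s => rlker a (t - s))).
Proof.
move=> a0; apply/(@integrable_itvP _ `[p, +oo[).
have /integrable_itvP := @integrable_rlker_le R a (t - p) a0.
have N1 : (-1 : R) != 0 by rewrite oppr_eq0 oner_eq0.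
move=> /(integrable_affine t N1); congr (_.-integrable _ _).
apply/funext => s /=; rewrite !in_itv /= andbT mulN1r (addrC (- s)) lerD2l lerN2.
by [].
Qed.

Lemma Rintegral_rlkerB a p t : 0 < a -> p <= t ->
  \int[mu]_(s in `[p, +oo[) rlker a (t - s) = (t - p) `^ a / a.
Proof.
move=> a0 pt; have /integrable_itvP ik := @integrable_rlker_le R a (t - p) a0.
transitivity (\int[mu]_(x in `]-oo, (t - p)%R]) rlker a x); last first.
  by apply: Rintegral_rlker_le; rewrite ?subr_ge0.
rewrite (Rintegral_itvE `[p, +oo[) (Rintegral_itvE `]-oo, t - p]).
have N1 : (-1 : R) != 0 by rewrite oppr_eq0 oner_eq0.
rewrite [RHS](Rintegral_affine t N1 ik) normrN1 mul1r.
apply: eq_Rintegral => s _; rewrite !in_itv /= andbT mulN1r (addrC (- s)) lerD2l lerN2.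
by [].
Qed.

(** A power is monotone in one sense or the other, so the sum of its values at the two end points
    bounds it whatever the sign of [e]. *)
Lemma powR_le_half (e y : R) : 2^-1 <= y -> y <= 1 -> y `^ e <= 1 + 2^-1 `^ e.
Proof.
move=> y2 y1; have h2 : 0 < 2^-1 :> R by rewrite invr_gt0.
have y0 := lt_le_trans h2 y2.
have [e0|e0] := leP 0 e.
  rewrite -[leLHS]addr0 lerD ?powR_ge0//.
  have -> : 1 = 1 `^ e :> R by rewrite powR1.
  by apply: ge0_ler_powR; rewrite // nnegrE ltW.
by rewrite -[leLHS]add0r lerD// le0_ler_powR// ltW.
Qed.

(** The singularities at 0 and at 1 are separated by cutting at 1/2: on each side one factor is
    bounded and the other integrable. [C] is large enough for both halves. *)
Lemma integrable_beta a b : 0 < a -> 0 < b ->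
  mu.-integrable setT (EFin \o (fun x => rlker a x * rlker b (1 - x))).
Proof.
move=> a0 b0; pose C : R := 1 + 2^-1 `^ (b - 1) + 2^-1 `^ (a - 1).
have hp (e : R) : 0 <= 2^-1 `^ e :> R by exact: powR_ge0.
have Cb : 1 + 2^-1 `^ (b - 1) <= C by rewrite lerDl.
have Ca : 1 + 2^-1 `^ (a - 1) <= C by rewrite /C addrAC lerDl.
have C0 : 0 <= C by apply: le_trans Ca; exact: addr_ge0.
pose g x := C * ((x \in `]-oo, 1])%:R * rlker a x + (x \in `[0, +oo[)%:R * rlker b (1 - x)).
apply: (@le_integrable_fun _ _ g) => //.
- apply: measurable_funM; first exact: measurable_rlker.
  exact: measurable_rlkerB.
- move=> x _; rewrite ger0_norm ?mulr_ge0 ?rlker_ge0// /g.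
  have [x0|x0] := leP x 0.
    by rewrite (@rlker_le0E _ a)// mul0r mulr0 add0r !mulr_ge0 ?rlker_ge0.
  have [x1|x1] := leP 1 x.
    rewrite (@rlker_le0E _ b) ?subr_le0// !mulr0 addr0.
    by rewrite !mulr_ge0 ?rlker_ge0.
  rewrite !in_itv /= (ltW x1) (ltW x0) /= !mul1r.
  have [x2|x2] := leP x 2^-1.
    rewrite (@le_trans _ _ (C * rlker a x))//; last first.
      by rewrite ler_wpM2l// lerDl rlker_ge0.
    rewrite mulrC ler_wpM2r ?rlker_ge0// rlker_gt0E ?subr_gt0//.
    by apply: le_trans Cb; apply: powR_le_half; lra.
  rewrite (@le_trans _ _ (C * rlker b (1 - x)))//; last first.
    by rewrite ler_wpM2l// lerDr rlker_ge0.
  rewrite ler_wpM2r ?rlker_ge0// rlker_gt0E//.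
  by apply: le_trans Ca; apply: powR_le_half; lra.
- apply: integrable_cstM => //; apply: integrableDr => //.
    exact/integrable_itvP/integrable_rlker_le.
  exact/integrable_itvP/integrable_rlkerB.
Qed.

(** The classical Beta integral over ]0, 1[: one of the two kernels vanishes at every other
    point. *)
Definition Beta a b : R := \int[mu]_x (rlker a x * rlker b (1 - x)).

(** The substitution u = (t - s) x + s and homogeneity extract (t - s)^(a-1) and (t - s)^(b-1), and
    the Jacobian supplies the missing factor t - s. In the extended reals the identity also proves
    that the convolution is integrable. *)
Lemma integral_conv_rlker a b s t : 0 < a -> 0 < b ->
  (\int[mu]_u (rlker a (u - s) * rlker b (t - u))%:E =
   (Beta a b * rlker (a + b) (t - s))%:E)%E.
Proof.
move=> a0 b0; have [st|ts] := ltP s t; last first.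
  rewrite (@rlker_le0E _ (a + b)) ?subr_le0// mulr0.
  rewrite (@eq_integral _ _ _ mu setT (cst 0%E)) ?integral0// => u _.
  have [us|us] := leP u s; first by rewrite rlker_le0E ?subr_le0// mul0r.
  by rewrite (@rlker_le0E _ b) ?mulr0// subr_le0 (le_trans ts)// ltW.
have d0 : 0 < t - s by rewrite subr_gt0.
have d00 : t - s != 0 by rewrite gt_eqF.
rewrite (ge0_integral_affine s d00); last 2 first.
- apply/measurable_EFinP; apply: measurable_funM; first exact: measurable_rlkerBr.
  exact: measurable_rlkerB.
- by move=> x; rewrite lee_fin mulr_ge0 ?rlker_ge0.
rewrite (@eq_integral _ _ _ mu setT (fun x =>
  ((t - s) `^ (a - 1) * (t - s) `^ (b - 1))%:E * (rlker a x * rlker b (1 - x))%:E)%E).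
  rewrite integralZl//; last exact: integrable_beta.
  rewrite /Beta /Rintegral -(fineK (integrable_fin_num measurableT (integrable_beta a0 b0))).
  rewrite -!EFinM; congr EFin.
  rewrite gtr0_norm// rlker_gt0E// [RHS]mulrC mulrA; congr (_ * _).
  rewrite (_ : a + b - 1 = 1 + (a - 1) + (b - 1)); last by ring.
  by rewrite !powRD ?d00 ?implybT// powRr1 ?mulrA// ltW.
move=> x _; rewrite -EFinM; congr EFin.
rewrite addrK (_ : t - (_ + _) = (t - s) * (1 - x)); last first.
  by rewrite mulrBr mulr1 opprD addrCA addrC.
by rewrite !rlkerM// mulrACA.
Qed.

(* Tonelli for rlker a x * rlker (1 - a) (s - x) * expR (- s): the inner integral
   in x is, by homogeneity, Beta a (1 - a) * expR (- s) for s > 0. *)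
Lemma GammaM_Beta a : 0 < a -> a < 1 -> Gamma a * Gamma (1 - a) = Beta a (1 - a).
Proof.
move=> a0 a1; set b := 1 - a.
have b0 : 0 < b by rewrite subr_gt0.
have b1 : b <= 1 by rewrite /b gerBl ltW.
have ia := integrable_Gamma a0 (ltW a1); have ib := integrable_Gamma b0 b1.
apply: EFin_inj; rewrite EFinM !GammaE /Rintegral.
rewrite fineK; last exact: (integrable_fin_num measurableT ia).
rewrite fineK; last exact: (integrable_fin_num measurableT ib).
have mE := @measurable_expRN R.
have mg c : measurable_fun setT (fun x : R => rlker c x * expR (- x)).
  by apply: measurable_funM => //; exact: measurable_rlker.
have g0 c x : 0 <= rlker c x * expR (- x) by rewrite mulr_ge0 ?rlker_ge0 ?expR_ge0.
pose F (z : R * R) := rlker a z.1 * rlker b (z.2 - z.1) * expR (- z.2).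
have mF : measurable_fun setT F.
  apply: measurable_funM; last exact: measurableT_comp mE _.
  apply: measurable_funM; first exact: measurableT_comp (measurable_rlker a) _.
  apply: measurableT_comp (measurable_rlker b) _.
  exact: measurable_funB.
have F0 z : 0 <= F z by rewrite !mulr_ge0 ?rlker_ge0 ?expR_ge0.
transitivity (\int[mu]_x \int[mu]_s (F (x, s))%:E)%E.
  rewrite -ge0_integralZr//; last 3 first.
  - by apply/measurable_EFinP; exact: mg.
  - by move=> x _; rewrite lee_fin.
  - by apply: integral_ge0 => x _; rewrite lee_fin.
  apply: eq_integral => x _; rewrite -ge0_integralZl_EFin//; last 2 first.
  - by move=> y _; rewrite lee_fin.
  - by apply/measurable_EFinP; exact: mg.
  (* The translation s -> s + x turns [F] into the product of the two Gamma integrands, since expR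
     (- (s + x)) splits. *)
  rewrite [RHS](ge0_integral_affine x (oner_neq0 R)); last 2 first.
  - by apply/measurable_EFinP; exact: (measurableT_comp mF).
  - by move=> y; rewrite lee_fin.
  rewrite normr1 mul1e; apply: eq_integral => s _; rewrite -EFinM /F /=; congr EFin.
  by rewrite mul1r addrK opprD addrC expRD mulrACA.
rewrite (@fubini_tonelli _ _ _ _ _ mu mu (EFin \o F))//; last first.
  exact/measurable_EFinP.
transitivity (\int[mu]_s ((Beta a b)%:E * (exponential_pdf 1 s)%:E))%E; last first.
  rewrite integralZl ?integral_exponential_pdf ?mule1//.
  exact: integrable_exponential_pdf.
apply: ae_eq_integral => //.
- apply: (@measurable_fun_fubini_tonelli_G _ _ _ _ _ mu (EFin \o F)) => //.
  exact/measurable_EFinP.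
- by apply: emeasurable_funM => //; apply/measurable_EFinP; exact: measurable_exponential_pdf.
exists [set 0]; split => //; first exact: lebesgue_measure_set1.
move=> s /= /not_implyP[_]; apply: contra_notP => s0.
rewrite /F /=.
rewrite (@eq_integral _ _ _ mu setT (fun x =>
  ((expR (- s))%:E * (rlker a (x - 0) * rlker b (s - x))%:E)%E)); last first.
  by move=> x _; rewrite -EFinM subr0 mulrC.
rewrite ge0_integralZl_EFin ?expR_ge0//; last 2 first.
- by move=> x _; rewrite lee_fin mulr_ge0 ?rlker_ge0.
- apply/measurable_EFinP; apply: measurable_funM; first exact: measurable_rlkerBr.
  exact: measurable_rlkerB.
rewrite integral_conv_rlker// subr0 -!EFinM; congr EFin.
rewrite mulrCA; congr (_ * _); rewrite /b addrCA subrr addr0.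
have [s1|] := ltP 0 s.
  by rewrite exponential_pdfE ?(ltW s1)// rlker_gt0E// subrr powRr0 mulr1 mul1r mulN1r.
rewrite le_eqVlt => /predU1P[//|s1].
by rewrite lt0_exponential_pdf// rlker_le0E ?(ltW s1)// mulr0.
Qed.

End Beta.

(** * Fubini and Hölder continuity for convolutions with the kernel *)

Section Convolution.
Context {R : realType}.
Local Notation mu := (@lebesgue_measure R).
Local Notation intg D f := (mu.-integrable D (EFin \o (f : R -> R))).
Implicit Types (a b p q s t x M : R) (f g : R -> R).

(** An integrable function is finite almost everywhere, so [fine] changes nothing. This carries
    Fubini, whose inner integrals are extended reals, over to real iterated integrals. *)
Lemma integrable_fine (K : R -> \bar R) : mu.-integrable setT K ->
  mu.-integrable setT (EFin \o (fine \o K)) /\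
  fine (\int[mu]_x K x) = \int[mu]_x fine (K x).
Proof.
move=> iK; have mK := measurable_int mu iK.
have mfK : measurable_fun setT (EFin \o (fine \o K)).
  by apply/measurable_EFinP; apply: measurableT_comp => //; exact: measurable_fine.
split.
  apply: le_integrable iK => //.
  by move=> x _ /=; case: (K x) => [r||] //=; rewrite normr0 leey.
rewrite /Rintegral; congr fine; apply: ae_eq_integral => //.
have := integrable_ae measurableT iK.
by apply: filterS => x h xT; rewrite /= fineK// h.
Qed.

Lemma integrable_prodP (H : R * R -> R) : measurable_fun setT H ->
  (\int[mu]_x \int[mu]_y `|(H (x, y))%:E| < +oo)%E ->
  (mu \x mu)%E.-integrable setT (EFin \o H).
Proof.
move=> mH iH; apply/integrable12ltyP => //.
exact/measurable_EFinP.
Qed.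

Lemma integrable_Rfubini_l (H : R * R -> R) : measurable_fun setT H ->
  (\int[mu]_x \int[mu]_y `|(H (x, y))%:E| < +oo)%E ->
  intg setT (fun x => \int[mu]_y H (x, y)).
Proof.
move=> mH iH; have iHp := integrable_prodP mH iH.
exact: (integrable_fine (integrable_fubini_F iHp)).1.
Qed.

Lemma fubini_swap_lty (H : R * R -> R) : measurable_fun setT H ->
  (\int[mu]_x \int[mu]_y `|(H (x, y))%:E| < +oo)%E ->
  (\int[mu]_y \int[mu]_x `|(H (x, y))%:E| < +oo)%E.
Proof.
move=> mH; rewrite (@fubini_tonelli _ _ _ _ _ mu mu (fun z => `|(H z)%:E|%E))//.
by apply: measurableT_comp => //; exact/measurable_EFinP.
Qed.

Lemma integrable_Rfubini_r (H : R * R -> R) : measurable_fun setT H ->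
  (\int[mu]_x \int[mu]_y `|(H (x, y))%:E| < +oo)%E ->
  intg setT (fun y => \int[mu]_x H (x, y)).
Proof.
move=> mH iH; apply: (@integrable_Rfubini_l (fun z => H (z.2, z.1))).
  by apply: measurableT_comp mH _; exact: measurable_swap.
exact: fubini_swap_lty.
Qed.

Lemma Rintegral_fubini (H : R * R -> R) : measurable_fun setT H ->
  (\int[mu]_x \int[mu]_y `|(H (x, y))%:E| < +oo)%E ->
  \int[mu]_x \int[mu]_y H (x, y) = \int[mu]_y \int[mu]_x H (x, y).
Proof.
move=> mH iH; have iHp := integrable_prodP mH iH.
have mH2 : measurable_fun setT (fun z : R * R => H (z.2, z.1)).
  by apply: measurableT_comp mH _; exact: measurable_swap.
have iHp2 := integrable_prodP mH2 (fubini_swap_lty mH iH).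
have [_ EF] := integrable_fine (integrable_fubini_F iHp).
have [_ EG] := integrable_fine (integrable_fubini_F iHp2).
by move: EF EG => /esym + /esym => EF EG; rewrite [LHS]EF [RHS]EG; congr fine; exact: (Fubini iHp).
Qed.

Lemma integrable_conv a t p M f : 0 < a -> measurable_fun setT f ->
  (forall s, `|f s| <= M * (s \in `[p, +oo[)%:R) ->
  intg setT (fun s => rlker a (t - s) * f s).
Proof.
move=> a0 mf fM.
apply: (@le_integrable_fun _ _ (fun s => M * ((s \in `[p, +oo[)%:R * rlker a (t - s)))) => //.
- by apply: measurable_funM => //; exact: measurable_rlkerB.
- move=> s _; rewrite normrM (ger0_norm (rlker_ge0 _ _)) mulrC mulrA.
  by rewrite ler_wpM2r ?rlker_ge0.
- by apply: integrable_cstM => //; exact/integrable_itvP/integrable_rlkerB.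
Qed.

Lemma measurable_conv_integrand a f g : measurable_fun setT f -> measurable_fun setT g ->
  measurable_fun setT (fun z : R * R => g z.1 * rlker a (z.1 - z.2) * f z.2).
Proof.
move=> mf mg; apply: measurable_funM; last exact: measurableT_comp mf _.
apply: measurable_funM; first exact: measurableT_comp mg _.
by apply: measurableT_comp (measurable_rlker a) _; exact: measurable_funB.
Qed.

(** [g] is merely integrable, because it will be a singular kernel or carry the weight (t1 -
    t)^(beta-1). Boundedness of [f] bounds the inner integral by |g t| times M (q - p)^a / a, as
    only t <= q matters. *)
Lemma conv_finite a p q M f g : 0 < a -> p <= q -> 0 <= M ->
  (forall s, `|f s| <= M * (s \in `[p, +oo[)%:R) -> measurable_fun setT f ->
  intg setT g -> (forall t, q < t -> g t = 0) ->
  (\int[mu]_t \int[mu]_s `|(g t * rlker a (t - s) * f s)%:E| < +oo)%E.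
Proof.
move=> a0 pq M0 fM mf ig gq; have mg := integrable_measurable ig.
pose C := M * ((q - p) `^ a / a).
have C0 : 0 <= C by rewrite mulr_ge0// divr_ge0 ?powR_ge0 ?ltW.
have iC : mu.-integrable setT (EFin \o (fun t => C * `|g t|)).
  by apply: integrable_cstM => //; exact: (integrable_norm ig).
have := integrable_lty measurableT iC; apply: le_lt_trans.
have mH := @measurable_conv_integrand a f g mf mg.
apply: ge0_le_integral => //.
- by move=> t _; apply: integral_ge0 => s _.
- apply: (@measurable_fun_fubini_tonelli_F _ _ _ _ _ mu
    (fun z : R * R => `|(g z.1 * rlker a (z.1 - z.2) * f z.2)%:E|%E)).
  + by apply: measurableT_comp => //; exact/measurable_EFinP.
  + by move=> z; exact: abse_ge0.
- exact: (measurable_int mu).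
move=> t _.
have [qt|tq] := ltP q t.
  rewrite (@eq_integral _ _ _ mu setT (cst 0%E)).
    by rewrite integral0 lee_fin mulr_ge0.
  by move=> s _; rewrite gq// !mul0r abse0.
pose h s := `|g t| * (M * ((s \in `[p, +oo[)%:R * rlker a (t - s))).
have ih : intg setT h.
  do 2! apply: integrable_cstM => //; exact/integrable_itvP/integrable_rlkerB.
apply: (@le_trans _ _ (\int[mu]_s (h s)%:E)%E).
  apply: ge0_le_integral => //.
  - apply: measurableT_comp => //; apply/measurable_EFinP.
    by apply: measurable_funM => //; apply: measurable_funM => //; exact: measurable_rlkerB.
  - exact: (measurable_int mu).
  move=> s _; rewrite lee_fin !normrM (ger0_norm (rlker_ge0 _ _)) -mulrA.
  by rewrite ler_wpM2l// mulrA mulrC ler_wpM2r ?rlker_ge0.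
rewrite -[leLHS]fineK; last exact: (integrable_fin_num measurableT ih).
have -> : fine (\int[mu]_s (h s)%:E)%E = \int[mu]_s h s by [].
have ik := (@integrable_rlkerB R a p t a0).
have ik1 : intg setT (fun s => (s \in `[p, +oo[)%:R * rlker a (t - s)) by exact/integrable_itvP.
rewrite /h RintegralZl//; last exact: integrable_cstM.
rewrite RintegralZl// -Rintegral_itvE lee_fin mulrC /C ler_wpM2r// ler_wpM2l//.
have [pt|tp] := leP p t.
  rewrite Rintegral_rlkerB// ler_wpM2r ?invr_ge0 ?(ltW a0)//.
  by apply: ge0_ler_powR; rewrite ?nnegrE ?subr_ge0 ?lerD2r// ltW.
rewrite Rintegral_itvE (@eq_Rintegral _ _ _ _ _ (cst 0)).
  by rewrite /Rintegral integral0 /= divr_ge0 ?powR_ge0 ?ltW.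
move=> s _; rewrite in_itv /= andbT; have [ps|_] := leP p s; last by rewrite mul0r.
by rewrite rlker_le0E ?mulr0// subr_le0 (le_trans _ ps)// ltW.
Qed.

(** For a <= 1 the kernel decreases, so the absolute value of its increment integrates exactly: no
    estimate of a derivative is involved. *)
Lemma conv_holder a t t' p M f : 0 < a -> a <= 1 -> 0 <= M -> measurable_fun setT f ->
  (forall s, `|f s| <= M * (s \in `[p, +oo[)%:R) -> t <= t' ->
  `|\int[mu]_s (rlker a (t' - s) * f s) - \int[mu]_s (rlker a (t - s) * f s)| <=
  2 * M / a * (t' - t) `^ a.
Proof.
(* [p0] lies to the left of t and t', so that the explicit integral formula applies to all three
   kernels. *)
move=> a0 a1 M0 mf fM tt'; pose p0 := Num.min p t.
have fM0 s : `|f s| <= M * (s \in `[p0, +oo[)%:R.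
  apply: (le_trans (fM s)); rewrite ler_wpM2l// ler_nat !in_itv /= !andbT.
  by rewrite /p0 ge_min; case: (p <= s).
have p0t : p0 <= t by rewrite /p0 ge_min lexx orbT.
have ic u := @integrable_conv a u _ _ _ a0 mf fM.
have ik u : intg setT (fun s => (s \in `[p0, +oo[)%:R * rlker a (u - s)).
  exact/integrable_itvP/integrable_rlkerB.
have ik' : intg setT (fun s => (s \in `[t, +oo[)%:R * rlker a (t' - s)).
  exact/integrable_itvP/integrable_rlkerB.
rewrite -RintegralB//.
pose h s := (s \in `[p0, +oo[)%:R * rlker a (t - s)
   - (s \in `[p0, +oo[)%:R * rlker a (t' - s)
   + 2 * ((s \in `[t, +oo[)%:R * rlker a (t' - s)).
have ih : intg setT h.
  by apply: integrableDr => //; [exact: integrableBr|exact: integrable_cstM].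
apply: (@le_trans _ _ (\int[mu]_s (M * h s))).
  apply: le_normr_Rintegral_dom => //.
  - exact: integrableBr.
  - exact: integrable_cstM.
  move=> s _; rewrite -mulrBl normrM mulrC.
  have := fM0 s; rewrite /h !in_itv /= !andbT.
  have [ps|sp] := leP p0 s; last first.
    rewrite mulr0 normr_le0 => /eqP ->; rewrite normr0 mul0r !mul0r subrr add0r.
    by rewrite !mulr_ge0 ?rlker_ge0.
  rewrite mulr1 !mul1r => fs.
  apply: ler_pM => //.
  have [ts|st] := leP t s.
    rewrite (@rlker_le0E _ _ (t - s)) ?subr_le0// subr0 ger0_norm ?rlker_ge0//.
    by rewrite mul1r; have := rlker_ge0 a (t' - s); lra.
  rewrite mul0r mulr0 addr0 ler0_norm ?opprB// subr_le0.
  by apply: rlker_nincr; rewrite ?subr_gt0// lerD2r.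
rewrite RintegralZl// /h RintegralD//; [|exact: integrableBr|exact: integrable_cstM].
rewrite RintegralB// RintegralZl// -!Rintegral_itvE !Rintegral_rlkerB//; last first.
  exact: le_trans tt'.
rewrite (_ : 2 * M / a * _ = M * (2 * ((t' - t) `^ a / a))); last by ring.
rewrite ler_wpM2l// gerDr subr_le0 ler_wpM2r ?invr_ge0 ?(ltW a0)//.
by apply: ge0_ler_powR; rewrite ?nnegrE ?subr_ge0 ?lerD2r ?(le_trans p0t)// ltW.
Qed.

Lemma powR_small a e : 0 < a -> 0 < e ->
  exists2 d, 0 < d & forall x, 0 <= x -> x < d -> x `^ a < e.
Proof.
move=> a0 e0; exists (e `^ a^-1); first exact: powR_gt0.
move=> x x0 xd; rewrite -[ltRHS](@powRr1 _ e) ?(ltW e0)//.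
rewrite -(mulVf (lt0r_neq0 a0)) powRrM.
by apply: gt0_ltr_powR => //; rewrite nnegrE ?powR_ge0.
Qed.

Lemma conv_continuous a p M f : 0 < a -> a <= 1 -> 0 <= M -> measurable_fun setT f ->
  (forall s, `|f s| <= M * (s \in `[p, +oo[)%:R) ->
  continuous (fun t => \int[mu]_s (rlker a (t - s) * f s)).
Proof.
move=> a0 a1 M0 mf fM t; apply/cvgrPdist_lt => e e0.
pose K := 2 * M / a + 1.
have K1 : 2 * M / a < K by rewrite ltrDl.
have K0 : 0 < K by apply: le_lt_trans K1; rewrite divr_ge0 ?mulr_ge0// ltW.
have [d d0 Hd] := powR_small a0 (divr_gt0 e0 K0).
near=> u.
have ud : `|t - u| < d by near: u; exact: cvgr_dist_lt.
have E : `|\int[mu]_s (rlker a (t - s) * f s) - \int[mu]_s (rlker a (u - s) * f s)| <=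
    2 * M / a * `|t - u| `^ a.
  have [ut|tu] := leP u t.
    by rewrite (@ger0_norm _ (t - u)) ?subr_ge0//; exact: conv_holder fM ut.
  rewrite distrC (distrC t) (@ger0_norm _ (u - t)) ?subr_ge0 ?(ltW tu)//.
  exact: conv_holder fM (ltW tu).
apply: (le_lt_trans E).
have := Hd _ (normr_ge0 _) ud; rewrite ltr_pdivlMr// => h.
apply: le_lt_trans h; rewrite mulrC ler_wpM2l ?powR_ge0// ltW.
Unshelve. all: by end_near. Qed.

End Convolution.

(** * Fractional integrals as convolutions, and their semigroup law *)

Section FractionalIntegrals.
Context {R : realType}.
Local Notation mu := (@lebesgue_measure R).
Local Notation intg D f := (mu.-integrable D (EFin \o (f : R -> R))).
Implicit Types (a b p q s t x M : R) (f g : R -> R).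

(** Absorbs the point where the kernel is 0 while the literal power is 0 ^ 0 = 1. *)
Lemma eq_Rintegral_except (c : R) f g : measurable_fun setT f -> measurable_fun setT g ->
  (forall x, x <> c -> f x = g x) -> \int[mu]_x f x = \int[mu]_x g x.
Proof.
move=> mf mg fg; rewrite /Rintegral; congr fine; apply: ae_eq_integral => //.
- exact/measurable_EFinP.
- exact/measurable_EFinP.
exists [set c]; split => //; first exact: lebesgue_measure_set1.
by move=> x /= /not_implyP[_]; apply: contra_notP => xc; rewrite fg.
Qed.

Variables (t0 t1 : R).

Definition clip f s := (s \in `[t0, t1])%:R * f s.

Lemma clip_bounded f M : 0 <= M -> (forall s, s \in `[t0, t1] -> `|f s| <= M) ->
  forall s, `|clip f s| <= M * (s \in `[t0, +oo[)%:R.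
Proof.
move=> M0 fM s; rewrite /clip normrM normr_nat.
have [h|h] := boolP (s \in `[t0, t1]); last by rewrite mul0r mulr_ge0.
rewrite mul1r (_ : s \in `[t0, +oo[) ?mulr1 ?fM//.
by move: h; rewrite !in_itv /= andbT => /andP[].
Qed.

Lemma measurable_clip f : measurable_fun `[t0, t1] f -> measurable_fun setT (clip f).
Proof. exact: measurable_itvM. Qed.

(* These are Gamma a times the fractional integrals of Defs. *)
Definition Ileft a f t := \int[mu]_s (rlker a (t - s) * clip f s).
Definition Iright a f t := \int[mu]_s (rlker a (s - t) * clip f s).

Lemma RintegralE_left a f t : measurable_fun `[t0, t1] f -> t \in `[t0, t1] ->
  \int[mu]_(s in `[t0, t]) ((t - s) `^ (a - 1) * f s) = Ileft a f t.
Proof.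
move=> mf; rewrite in_itv /= => /andP[t0t tt1]; rewrite Rintegral_itvE.
have mc := measurable_clip mf.
have H s : s <> t -> (s \in `[t0, t])%:R * ((t - s) `^ (a - 1) * f s)
    = rlker a (t - s) * clip f s.
  move=> /eqP st; rewrite /clip !in_itv /=.
  have [ts|ts] := ltP s t.
    rewrite rlker_gt0E ?subr_gt0// (ltW ts) andbT (le_trans (ltW ts) tt1) andbT.
    by rewrite mulrCA.
  by rewrite rlker_le0E ?subr_le0// mul0r andbC leNgt lt_neqAle eq_sym st ts /= mul0r.
apply: (@eq_Rintegral_except t) => //; last first.
  by apply: measurable_funM => //; exact: measurable_rlkerB.
(* Measurability of [f] is known on [t0, t1] only, so [f] gives way to its extension by zero. *)
have -> : (fun s => (s \in `[t0, t])%:R * ((t - s) `^ (a - 1) * f s)) =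
   (fun s => (s \in `[t0, t])%:R * (t - s) `^ (a - 1) * clip f s).
  apply/funext => s; rewrite /clip -!mulrA mulrCA [RHS]mulrCA !in_itv /=.
  case: (boolP (t0 <= s <= t)) => [/andP[-> st]|]; last by rewrite !mul0r !mulr0.
  by rewrite (le_trans st tt1) /= !mul1r.
apply: measurable_funM => //; apply: measurable_funM.
  exact: measurable_itv_indic.
by apply: (measurableT_comp (@measurable_powR R (a - 1))); exact: measurable_funB.
Qed.

Lemma RintegralE_right a f t : measurable_fun `[t0, t1] f -> t \in `[t0, t1] ->
  \int[mu]_(s in `[t, t1]) ((s - t) `^ (a - 1) * f s) = Iright a f t.
Proof.
move=> mf; rewrite in_itv /= => /andP[t0t tt1]; rewrite Rintegral_itvE.
have mc := measurable_clip mf.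
have H s : s <> t -> (s \in `[t, t1])%:R * ((s - t) `^ (a - 1) * f s)
    = rlker a (s - t) * clip f s.
  move=> /eqP st; rewrite /clip !in_itv /=.
  have [ts|ts] := ltP t s.
    rewrite rlker_gt0E ?subr_gt0// (ltW ts) (le_trans t0t (ltW ts)) /=.
    by rewrite mulrCA.
  by rewrite rlker_le0E ?subr_le0// mul0r leNgt lt_neqAle st ts /= mul0r.
apply: (@eq_Rintegral_except t) => //; last first.
  by apply: measurable_funM => //; exact: measurable_rlkerBr.
have -> : (fun s => (s \in `[t, t1])%:R * ((s - t) `^ (a - 1) * f s)) =
   (fun s => (s \in `[t, t1])%:R * (s - t) `^ (a - 1) * clip f s).
  apply/funext => s; rewrite /clip -!mulrA mulrCA [RHS]mulrCA !in_itv /=.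
  case: (boolP (t <= s <= t1)) => [/andP[st ->]|]; last by rewrite !mul0r !mulr0.
  by rewrite (le_trans t0t st) /= !mul1r.
apply: measurable_funM => //; apply: measurable_funM.
  exact: measurable_itv_indic.
by apply: (measurableT_comp (@measurable_powR R (a - 1))); exact: measurable_funB.
Qed.

Lemma integrable_conv_rlker a b s t : 0 < a -> 0 < b ->
  intg setT (fun u => rlker a (u - s) * rlker b (t - u)).
Proof.
move=> a0 b0; apply/integrableP; split.
  apply/measurable_EFinP; apply: measurable_funM; first exact: measurable_rlkerBr.
  exact: measurable_rlkerB.
under eq_integral do rewrite /= ger0_norm ?mulr_ge0 ?rlker_ge0//.
by rewrite integral_conv_rlker// ltry.
Qed.

Lemma Rintegral_conv_rlker a b s t : 0 < a -> 0 < b ->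
  \int[mu]_u (rlker a (u - s) * rlker b (t - u)) = Beta a b * rlker (a + b) (t - s).
Proof. by move=> a0 b0; rewrite /Rintegral integral_conv_rlker. Qed.

Lemma Ileft1E f t : measurable_fun `[t0, t1] f -> t \in `[t0, t1] ->
  \int[mu]_s (rlker 1 (t - s) * clip f s) = \int[mu]_(s in `[t0, t]) f s.
Proof.
move=> mf tI; rewrite -[LHS]/(Ileft 1 f t) -RintegralE_left//.
by apply: eq_Rintegral => s _; rewrite subrr powRr0 mul1r.
Qed.

(** After Fubini the inner integral convolves kernels of orders a and 1 - a. The result has order 1,
    that is, it is the indicator of s < t times the Beta constant. *)
Lemma Ileft_semigroup a f M t : 0 < a -> a < 1 -> 0 <= M -> measurable_fun `[t0, t1] f ->
  (forall s, s \in `[t0, t1] -> `|f s| <= M) -> t \in `[t0, t1] ->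
  Ileft (1 - a) (Ileft a f) t = Beta a (1 - a) * \int[mu]_(s in `[t0, t]) f s.
Proof.
move=> a0 a1 M0 mf fM tI; have b0 : 0 < 1 - a by rewrite subr_gt0.
have mc := measurable_clip mf; have cM := clip_bounded M0 fM.
move: (tI); rewrite in_itv /= => /andP[t0t tt1].
(* The cut at t0 makes the outer kernel integrable. It is invisible afterwards: [clip] imposes it
   already, and rlker a (u - s) vanishes for u <= s when s lies in [t0, t1]. *)
pose g u := (u \in `[t0, +oo[)%:R * rlker (1 - a) (t - u).
have ig : intg setT g by exact/integrable_itvP/integrable_rlkerB.
have gq u : t1 < u -> g u = 0.
  by move=> tu; rewrite /g rlker_le0E ?mulr0// subr_le0 (le_trans tt1)// ltW.
have fin := conv_finite a0 (le_trans t0t tt1) M0 cM mc ig gq.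
have mH := @measurable_conv_integrand R a (clip f) g mc (integrable_measurable ig).
have := Rintegral_fubini mH fin => /= E.
rewrite -Ileft1E//.
rewrite -RintegralZl//; last exact: (@integrable_conv _ 1 t t0 M).
transitivity (\int[mu]_x \int[mu]_y (g x * rlker a (x - y) * clip f y)).
  apply: eq_Rintegral => u _.
  under [RHS]eq_Rintegral do rewrite -mulrA.
  rewrite RintegralZl//; last exact: (@integrable_conv _ a u t0 M).
  rewrite /clip [LHS]mulrA; congr (_ * _); rewrite /g !in_itv /= andbT mulrC.
  have [ut1|ut1] := leP u t1; first by rewrite andbT.
  by rewrite rlker_le0E ?mulr0// subr_le0 (le_trans tt1)// ltW.
rewrite E; apply: eq_Rintegral => s _.
have [sI|sI] := boolP (s \in `[t0, t1]); last first.
  rewrite {2}/clip (negbTE sI) mul0r !mulr0.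
  rewrite (@eq_Rintegral _ _ _ _ _ (cst 0)) ?/Rintegral ?integral0//.
  by move=> u _; rewrite /clip (negbTE sI) mul0r mulr0.
have gE u : g u * rlker a (u - s) = rlker a (u - s) * rlker (1 - a) (t - u).
  rewrite /g in_itv /= andbT mulrC; have [us|us] := leP u s.
    by rewrite rlker_le0E ?subr_le0// !mul0r.
  rewrite (_ : t0 <= u) ?mul1r//.
  by move: sI; rewrite in_itv /= => /andP[h _]; rewrite (le_trans h)// ltW.
under eq_Rintegral do rewrite gE.
rewrite RintegralZr//; last exact: integrable_conv_rlker.
by rewrite Rintegral_conv_rlker// addrCA subrr addr0 mulrA.
Qed.

Lemma Ileft_continuous a f M : 0 < a -> a <= 1 -> 0 <= M -> measurable_fun `[t0, t1] f ->
  (forall s, s \in `[t0, t1] -> `|f s| <= M) -> continuous (Ileft a f).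
Proof.
move=> a0 a1 M0 mf fM; apply: (@conv_continuous _ _ t0 M) => //.
  exact: measurable_clip.
exact: clip_bounded.
Qed.

(** The difference quotient of the primitive is the mean of [f] over ]s, t], and a mean of values
    within [e] of [c] is within [e] of [c]. *)
Lemma Rintegral_slope f s t e c : t0 <= s -> s < t -> t <= t1 ->
  intg `[t0, t1]%classic f -> (forall u, u \in `[s, t] -> `|c - f u| <= e) ->
  `|c - (t - s)^-1 * (\int[mu]_(u in `[t0, t]) f u - \int[mu]_(u in `[t0, s]) f u)| <= e.
Proof.
move=> t0s st tt1 fi fe; have d0 : 0 < t - s by rewrite subr_gt0.
have it : intg `[t0, t]%classic f.
  by apply: integrableS fi => // u /=; rewrite !in_itv /= => /andP[-> /le_trans]; exact.
rewrite Rintegral_itvB// ?bnd_simp//; last exact: ltW.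
have ist : intg `]s, t]%classic f.
  apply: integrableS it => // u /=; rewrite !in_itv /= => /andP[h ->].
  by rewrite andbT (le_trans t0s)// ltW.
have cst_i (r : R) : intg `]s, t]%classic (fun=> r).
  apply: (@integrableS _ _ _ mu `[s, t]%classic) => //.
    by move=> u /=; rewrite !in_itv /= => /andP[/ltW -> ->].
  apply: continuous_compact_integrable; first exact: segment_compact.
  by apply: continuous_subspaceT => x; exact: cvg_cst.
have mst : mu (`]s, t]%classic : set R) = (t - s)%:E.
  by rewrite lebesgue_measure_itv /= lte_fin st.
have cstE (r : R) : \int[mu]_(u in `]s, t]) r = (t - s) * r.
  rewrite Rintegral_cst//.
  by rewrite mulrC; congr (_ * _); rewrite -[RHS]/(fine (t - s)%:E) -mst.
have -> : c = (t - s)^-1 * \int[mu]_(u in `]s, t]) c.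
  by rewrite cstE mulKf ?gt_eqF.
rewrite -mulrBr -RintegralB// normrM gtr0_norm ?invr_gt0// mulrC ler_pdivrMr//.
rewrite mulrC -cstE; apply: le_normr_Rintegral_dom => //; first exact: integrableBr.
by move=> u /=; rewrite in_itv /= => /andP[h1 h2]; apply: fe; rewrite in_itv /= h2 ltW.
Qed.

End FractionalIntegrals.

(** * The Caputo derivative inverts the left-sided integral *)

Section Caputo.
Context {R : realType} {n : nat}.
Local Notation mu := (@lebesgue_measure R).
Local Notation intg D f := (mu.-integrable D (EFin \o (f : R -> R))).
Variables (t0 t1 : R).
Implicit Types (phi psi : R -> 'rV[R]_n).

Lemma within_continuous_coord (T : topologicalType) (A : set T) (psi : T -> 'rV[R]_n) i : {within A, continuous psi} ->
  {within A, continuous (fun s => psi s 0 i)}.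
Proof.
move=> cpsi; apply: (@within_continuous_comp _ _ _ A psi (fun M : 'rV_n => M 0 i)) => //.
by move=> M _; exact: coord_continuous.
Qed.

Lemma RLleft_coord a phi t i : a != 0 -> t \in `[t0, t1] ->
  measurable_fun `[t0, t1] (fun s => phi s 0 i) ->
  RLleft t0 a phi t 0 i = (Gamma a)^-1 * Ileft t0 t1 a (fun s => phi s 0 i) t.
Proof.
move=> a0 tI mf; rewrite /RLleft (negbTE a0) !mxE; congr (_ * _).
by rewrite -RintegralE_left//; apply: eq_Rintegral => s _; rewrite !mxE.
Qed.

Lemma RLright_coord a phi t i : t \in `[t0, t1] ->
  measurable_fun `[t0, t1] (fun s => phi s 0 i) ->
  RLright t1 a phi t 0 i = (Gamma a)^-1 * Iright t0 t1 a (fun s => phi s 0 i) t.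
Proof.
move=> tI mf; rewrite /RLright !mxE; congr (_ * _).
by rewrite -RintegralE_right//; apply: eq_Rintegral => s _; rewrite !mxE.
Qed.

Lemma eq_Ileft a f g t : {in `[t0, t1], f =1 g} -> Ileft t0 t1 a f t = Ileft t0 t1 a g t.
Proof.
move=> fg; apply: eq_Rintegral => s _; rewrite /clip.
by have [sI|sI] := boolP (s \in `[t0, t1]); [rewrite fg|rewrite !mul0r].
Qed.

Lemma eq_Iright a f g t : {in `[t0, t1], f =1 g} -> Iright t0 t1 a f t = Iright t0 t1 a g t.
Proof.
move=> fg; apply: eq_Rintegral => s _; rewrite /clip.
by have [sI|sI] := boolP (s \in `[t0, t1]); [rewrite fg|rewrite !mul0r].
Qed.

Hypothesis t01 : t0 < t1.

(** Properness is what makes the limit defining [deriv_on] unique. Points of the interval other than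
    t are found to the right of t, or to the left when t = t1. *)
Lemma within_dnbhs_proper t : t \in `[t0, t1] ->
  ProperFilter (within `[t0, t1]%classic (t^')).
Proof.
rewrite in_itv /= => /andP[t0t tt1].
apply: Build_ProperFilter_ex => P.
rewrite /within /= /dnbhs /within /= => -[e e0 He].
have e2 : 0 < e / 2 by rewrite divr_gt0.
have [tt|tt] := ltP t t1.
  pose s := t + Num.min (e / 2) (t1 - t).
  have m0 : 0 < Num.min (e / 2) (t1 - t) by rewrite lt_min e2 subr_gt0.
  exists s; apply: He; rewrite /= /s.
  - rewrite opprD addrA subrr add0r normrN gtr0_norm// gt_min; apply/orP; left; lra.
  - by rewrite -subr_eq0 addrC addKr gt_eqF.
  - rewrite in_itv /=; have := ge_min (t1 - t) (e / 2) (t1 - t).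
    rewrite lexx orbT => h; apply/andP; split; lra.
pose s := t - Num.min (e / 2) (t1 - t0).
have m0 : 0 < Num.min (e / 2) (t1 - t0) by rewrite lt_min e2 subr_gt0.
exists s; apply: He; rewrite /= /s.
- rewrite opprD addrA subrr add0r opprK gtr0_norm// gt_min; apply/orP; left; lra.
- by rewrite -subr_eq0 addrC addKr oppr_eq0 gt_eqF.
- rewrite in_itv /=; have := ge_min (t1 - t0) (e / 2) (t1 - t0).
  rewrite lexx orbT => h; apply/andP; split; lra.
Qed.

Lemma deriv_on_primitive psi phi t : {within `[t0, t1], continuous psi} ->
  (forall s i, s \in `[t0, t1] -> phi s 0 i = \int[mu]_(u in `[t0, s]) psi u 0 i) ->
  t \in `[t0, t1] -> deriv_on t0 t1 phi t = psi t.
Proof.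
move=> cpsi phiE tI; have PF := within_dnbhs_proper tI.
apply: cvg_lim; first exact: norm_hausdorff.
apply/cvg_ballP => e e0; rewrite !near_withinE.
(* The bound on the mean is not strict while the ball is open, hence the half. *)
have e2 : 0 < e / 2 by rewrite divr_gt0.
have /subspace_continuousP/(_ t tI)/cvg_ballP/(_ _ e2) := cpsi.
rewrite near_withinE => -[d d0 Hd].
exists d => // s std snt sI; split=> // i j.
have il k : intg `[t0, t1]%classic (fun u => psi u 0 k).
  apply: continuous_compact_integrable; first exact: segment_compact.
  exact: within_continuous_coord.
move: tI sI (tI) (sI); rewrite /= !in_itv /= => /andP[t0t tt1] /andP[t0s st1] tI sI.
have H u : u \in `[t0, t1] -> `|t - u| < d -> `|psi t 0 j - psi u 0 j| <= e / 2.
  by move=> uI ud; have := (Hd u ud uI).2 0 j => /ltW.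
rewrite (ord1 i) /ball /=; apply: (@le_lt_trans _ _ (e / 2)); last by lra.
rewrite !mxE !phiE//; move: snt; rewrite neq_lt => /orP[st|ts].
  rewrite -(opprB t s) invrN -[X in _ * X]opprB mulrNN.
  apply: (@Rintegral_slope _ t0 t1) => // u; rewrite in_itv /= => /andP[su ut].
  apply: H; first by rewrite in_itv /=; apply/andP; split; lra.
  apply: le_lt_trans std; rewrite /ball_ /= !ger0_norm; lra.
apply: (@Rintegral_slope _ t0 t1) => // u; rewrite in_itv /= => /andP[su ut].
apply: H; first by rewrite in_itv /=; apply/andP; split; lra.
by apply: le_lt_trans std; rewrite /ball_ /= !ler0_norm; lra.
Qed.

Lemma caputo_RLleft a phi psi t : 0 < a -> a <= 1 ->
  {within `[t0, t1], continuous psi} ->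
  {in `[t0, t1], forall t, phi t = phi t0 + RLleft t0 a psi t} ->
  t \in `[t0, t1] -> caputo t0 t1 a phi t = psi t.
Proof.
move=> a0 a1 cpsi phiE; apply: deriv_on_primitive => // s i sI.
have cf : {within `[t0, t1], continuous (fun u => psi u 0 i)}.
  exact: within_continuous_coord.
have mf := measurable_continuous_itv cf.
have dE u : u \in `[t0, t1] ->
    (phi u - phi t0) 0 i = (Gamma a)^-1 * Ileft t0 t1 a (fun s => psi s 0 i) u.
  move=> uI; rewrite phiE// addrC addKr (RLleft_coord _ _ mf)// gt_eqF//.
have [a1'|a1'] := eqVneq a 1.
  rewrite /RLleft a1' subrr eqxx dE// a1' Gamma1 invr1 mul1r.
  exact: Ileft1E.
have {a1 a1'} a1 : a < 1 by rewrite lt_neqAle a1' a1.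
have [M M0 fM] := continuous_bounded_itv cf.
have cI := Ileft_continuous a0 (ltW a1) (ltW M0) mf fM.
have mI : measurable_fun `[t0, t1] (Ileft t0 t1 a (fun s => psi s 0 i)).
  by apply: measurable_funTS; exact: continuous_measurable_fun.
have mI' : measurable_fun `[t0, t1] (fun u => (Gamma a)^-1 * Ileft t0 t1 a (fun s => psi s 0 i) u).
  exact: measurable_funM.
have [M' M'0 IM] : exists2 M, 0 < M & forall x, x \in `[t0, t1] ->
     `|Ileft t0 t1 a (fun s => psi s 0 i) x| <= M.
  by apply: continuous_bounded_itv; exact: continuous_subspaceT.
have b0 : 0 < 1 - a by rewrite subr_gt0.
rewrite (RLleft_coord _ sI); last 2 first.
- by rewrite gt_eqF.
- apply: eq_measurable_fun mI' => u uI; rewrite -dE//.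
  by move: uI; rewrite inE.
rewrite (eq_Ileft _ _ dE).
have -> : Ileft t0 t1 (1 - a) (fun u => (Gamma a)^-1 * Ileft t0 t1 a (fun s => psi s 0 i) u) s
   = (Gamma a)^-1 * Ileft t0 t1 (1 - a) (Ileft t0 t1 a (fun s => psi s 0 i)) s.
  rewrite /Ileft -RintegralZl//.
    by apply: eq_Rintegral => u _; rewrite /clip; ring.
  apply: (@integrable_conv _ _ _ t0 M') => //; first exact: measurable_clip.
  by apply: clip_bounded => //; exact: ltW.
rewrite (Ileft_semigroup a0 a1 (ltW M0) mf fM sI) -GammaM_Beta//.
have G1 := Gamma_gt0 a0 (ltW a1).
have G2 : 0 < Gamma (1 - a) by apply: Gamma_gt0 => //; rewrite gerBl ltW.
move: G1 G2; move: (Gamma a) (Gamma (1 - a)) (\int[mu]_(_ in _) _) => u v w u0 v0.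
by field; rewrite !gt_eqF.
Qed.

End Caputo.

(** * Uniform estimates near the graph, and expansion along a direction *)

Section NearGraph.
Context {R : realType} {n : nat}.
Variables (t0 t1 : R).
Hypothesis t01 : t0 < t1.

(* Composing with this retraction turns continuity within [t0, t1] into plain
   continuity on the line. *)
Definition clamp (t : R) : R := Num.max t0 (Num.min t t1).

Lemma clampI t : clamp t \in `[t0, t1].
Proof.
rewrite in_itv /= /clamp le_max lexx /= ge_max (ltW t01) /=.
by rewrite ge_min lexx orbT.
Qed.

Lemma clampE t : t \in `[t0, t1] -> clamp t = t.
Proof.
rewrite in_itv /= => /andP[h1 h2]; rewrite /clamp (min_idPl h2).
exact/max_idPr.
Qed.

Lemma clamp_lipschitz (x y : R) : `|clamp x - clamp y| <= `|x - y|.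
Proof.
have t01' := t01; have [N NE] : exists N : R, N = `|x - y| by eexists.
have h1 : x - y <= N by rewrite NE ler_norm.
have h2 : y - x <= N by rewrite NE distrC ler_norm.
rewrite -NE /clamp ler_norml {NE}.
case: (leP x t1) => xt1; case: (leP y t1) => yt1; rewrite ?(max_r (ltW t01)).
all: case: (leP t0 x) => t0x; case: (leP t0 y) => t0y; apply/andP; split; lra.
Qed.

Lemma continuous_clamp : continuous clamp.
Proof.
move=> t; apply/cvgrPdist_lt => e e0; near=> u.
apply: (le_lt_trans (clamp_lipschitz t u)).
by near: u; exact: cvgr_dist_lt.
Unshelve. all: by end_near. Qed.

Lemma cvg_to_within (T S : topologicalType) (A : set S) (f : T -> S) x :
  {for x, continuous f} -> (\forall y \near x, A (f y)) ->
  f @ nbhs x --> within A (nbhs (f x)).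
Proof.
move=> cf Af B; rewrite /within /= => h.
have h1 : \forall y \near x, A (f y) -> B (f y) := cf _ h.
by apply: filterS2 h1 Af => y; exact.
Qed.

Lemma continuous_comp_clamp (V : topologicalType) (f : R -> V) :
  {within `[t0, t1], continuous f} -> continuous (f \o clamp).
Proof.
move=> /subspace_continuousP cf t.
apply: (@cvg_comp _ _ _ clamp f _ (within `[t0, t1]%classic (nbhs (clamp t)))).
  apply: cvg_to_within; first exact: continuous_clamp.
  exact: (@filterE _ (nbhs t) _ _ (fun y => clampI y)).
by apply: cf; exact: clampI.
Qed.

(** Around each single t this is continuity of [G] at a point of the graph; compactness of [t0, t1]
    makes one radius serve all t. *)
Lemma uniform_near_graph (U : set (R * 'rV[R]_n * 'rV[R]_n))
    (G : R * 'rV[R]_n * 'rV[R]_n -> R) (x y : R -> 'rV[R]_n) :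
  open U -> {within U `&` [set p | p.1.1 \in `[t0, t1]], continuous G} ->
  {within `[t0, t1], continuous x} -> {within `[t0, t1], continuous y} ->
  {in `[t0, t1], forall t, U (t, x t, y t)} ->
  forall e : R, 0 < e -> exists2 r : R, 0 < r & forall t u v, t \in `[t0, t1] ->
    `|u| < r -> `|v| < r -> U (t, x t + u, y t + v) /\
    `|G (t, x t + u, y t + v) - G (t, x t, y t)| < e.
Proof.
move=> oU cG cx cy Uxy e e0.
pose xc := x \o clamp; pose yc := y \o clamp.
have cxc : continuous xc by exact: continuous_comp_clamp.
have cyc : continuous yc by exact: continuous_comp_clamp.
pose Phi (z : R * ('rV[R]_n * 'rV[R]_n)) : R * 'rV[R]_n * 'rV[R]_n :=
  (clamp z.1, xc z.1 + z.2.1, yc z.1 + z.2.2).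
have cPhi : continuous Phi.
  move=> z; apply: (@cvg_pair _ _ _ _ (nbhs _)); last first.
    apply: cvgD; last by apply: cvg_comp; [exact: cvg_snd|exact: cvg_snd].
    by apply: cvg_comp; [exact: cvg_fst|exact: cyc].
  apply: (@cvg_pair _ _ _ _ (nbhs _)).
    by apply: cvg_comp; [exact: cvg_fst|exact: continuous_clamp].
  apply: cvgD; last by apply: cvg_comp; [exact: cvg_snd|exact: cvg_fst].
  by apply: cvg_comp; [exact: cvg_fst|exact: cxc].
(* The unperturbed graph, with the same variables as [Phi], so that the increment of [G] becomes one
   function of (t, (u, v)), continuous at and vanishing on (t, (0, 0)). Clamping keeps nearby times
   inside the interval to which continuity of [G] is relative. *)
pose Psi (z : R * ('rV[R]_n * 'rV[R]_n)) : R * 'rV[R]_n * 'rV[R]_n :=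
  (clamp z.1, xc z.1, yc z.1).
have cPsi : continuous Psi.
  move=> z; apply: (@cvg_pair _ _ _ _ (nbhs _)); last first.
    by apply: cvg_comp; [exact: cvg_fst|exact: cyc].
  apply: (@cvg_pair _ _ _ _ (nbhs _)).
    by apply: cvg_comp; [exact: cvg_fst|exact: continuous_clamp].
  by apply: cvg_comp; [exact: cvg_fst|exact: cxc].
have PsiI t uv : t \in `[t0, t1] -> Psi (t, uv) = (t, x t, y t).
  by move=> tI; rewrite /Psi /xc /yc /= clampE.
have PhiI t : t \in `[t0, t1] -> Phi (t, (0, 0)) = (t, x t, y t).
  by move=> tI; rewrite /Phi /xc /yc /= !addr0 clampE.
have UPhi t : t \in `[t0, t1] -> \forall z \near (t, (0 : 'rV[R]_n, 0 : 'rV[R]_n)), U (Phi z).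
  by move=> tI; apply: cPhi; rewrite PhiI//; apply: open_nbhs_nbhs; split => //; exact: Uxy.
have UPsi t : t \in `[t0, t1] -> \forall z \near (t, (0 : 'rV[R]_n, 0 : 'rV[R]_n)), U (Psi z).
  move=> tI; apply: cPsi; rewrite PsiI//; apply: open_nbhs_nbhs; split => //; exact: Uxy.
have cGPhi t : t \in `[t0, t1] -> {for (t, (0 : 'rV[R]_n, 0 : 'rV[R]_n)), continuous (G \o Phi)}.
  move=> tI; move/subspace_continuousP : cG => cG.
  apply: (@cvg_comp _ _ _ Phi G _ (within (U `&` [set p | p.1.1 \in `[t0, t1]]) (nbhs (Phi (t, (0, 0)))))).
    apply: cvg_to_within; first exact: cPhi.
    have := UPhi t tI; apply: filterS => z Uz; split => //=.
    exact: clampI.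
  by apply: cG; rewrite PhiI//; split => //; exact: Uxy.
have cGPsi t : t \in `[t0, t1] -> {for (t, (0 : 'rV[R]_n, 0 : 'rV[R]_n)), continuous (G \o Psi)}.
  move=> tI; move/subspace_continuousP : cG => cG.
  apply: (@cvg_comp _ _ _ Psi G _ (within (U `&` [set p | p.1.1 \in `[t0, t1]]) (nbhs (Psi (t, (0, 0)))))).
    apply: cvg_to_within; first exact: cPsi.
    have := UPsi t tI; apply: filterS => z Uz; split => //=.
    exact: clampI.
  by apply: cG; rewrite PsiI//; split => //; exact: Uxy.
(* Compactness in its near-covering form: a property valid near each (t, 0) holds for all t at once
   when (u, v) is near 0. *)
have /compact_near_coveringP K := @segment_compact R t0 t1.
have HK : \forall uv \near nbhs (0 : 'rV[R]_n, 0 : 'rV[R]_n),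
    `[t0, t1]%classic `<=` (fun t => t \in `[t0, t1] -> U (Phi (t, uv)) /\
    `|G (Phi (t, uv)) - G (Psi (t, uv))| < e).
  apply: (K _ (nbhs (0 : 'rV[R]_n, 0 : 'rV[R]_n)) (fun uv t => t \in `[t0, t1] ->
    U (Phi (t, uv)) /\ `|G (Phi (t, uv)) - G (Psi (t, uv))| < e)) => t tI.
  have c0 : {for (t, (0 : 'rV[R]_n, 0 : 'rV[R]_n)), continuous (fun z => G (Phi z) - G (Psi z))}.
    by apply: cvgB; [exact: cGPhi|exact: cGPsi].
  have : \forall z \near (t, (0 : 'rV[R]_n, 0 : 'rV[R]_n)), `|G (Phi z) - G (Psi z)| < e.
    move/cvgrPdist_lt : c0 => /(_ _ e0); apply: filterS => z.
    by rewrite PsiI// PhiI// subrr sub0r normrN.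
  have := UPhi t tI => h1 h2.
  have h4 : nbhs (t, (0 : 'rV[R]_n, 0 : 'rV[R]_n)) (fun z => z.1 \in `[t0, t1] ->
      U (Phi (z.1, z.2)) /\ `|G (Phi (z.1, z.2)) - G (Psi (z.1, z.2))| < e).
    by apply: filterS2 h1 h2 => -[t' uv].
  exact: h4.
have /nbhs_ballP[r r0 Hr] := HK; exists r => // t u v tI ur vr.
have := Hr (u, v) _ t tI tI.
rewrite PsiI// /Phi /xc /yc /= clampE//; apply.
by split; rewrite /= -ball_normE /= sub0r normrN.
Qed.

(** The mean value theorem for the restriction of [f] to a line; [e] bounds the oscillation of the
    directional derivative around the reference value [d]. The two signs of [h] are treated apart
    because the theorem wants an ordered interval. *)
Lemma MVT_direction (f : 'rV[R]_n -> R) (z v : 'rV[R]_n) (h d e : R) :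
  (forall r, `|r| <= `|h| -> derivable f (z + r *: v) v /\
     `|'D_v f (z + r *: v) - d| <= e) ->
  `|f (z + h *: v) - f z - h * d| <= e * `|h|.
Proof.
move=> H; pose phi (r : R) := f (z + r *: v).
have E r : (fun h : R => h^-1 *: ((phi \o shift r) (h *: 1) - phi r)) =
    (fun h : R => h^-1 *: ((f \o shift (z + r *: v)) (h *: v) - f (z + r *: v))).
  apply/funext => k /=; rewrite /phi /= scaler1; congr (_ *: (f _ - _)).
  by rewrite scalerDl addrCA.
have D (r : R) : `|r| <= `|h| -> is_derive r (1 : R) phi ('D_v f (z + r *: v)).
  move=> /H[dr _]; apply: DeriveDef; first by rewrite /derivable E.
  by rewrite /derive E.
have C (a b : R) : a <= b -> `|a| <= `|h| -> `|b| <= `|h| -> {within `[a, b], continuous phi}.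
  move=> ab ah bh; apply: derivable_within_continuous => r; rewrite in_itv /= => /andP[ar rb].
  have rh : `|r| <= `|h|.
    rewrite ler_norml; move: ah bh; rewrite !ler_norml => /andP[? ?] /andP[? ?].
    by apply/andP; split; lra.
  by have [] := D r rh.
have M (a b : R) : a < b -> `|a| <= `|h| -> `|b| <= `|h| ->
    exists2 c, `|c| <= `|h| & phi b - phi a = 'D_v f (z + c *: v) * (b - a).
  move=> ab ah bh.
  have rh r : a <= r <= b -> `|r| <= `|h|.
    move=> /andP[ar rb].
    rewrite ler_norml; move: ah bh; rewrite !ler_norml => /andP[? ?] /andP[? ?].
    by apply/andP; split; lra.
  have [||c cI Hc] := @MVT R phi (fun r => 'D_v f (z + r *: v)) a b ab.
  - move=> r; rewrite in_itv /= => /andP[/ltW h1 /ltW h2]; apply: D; apply: rh; exact/andP.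
  - by apply: C => //; exact: ltW.
  exists c => //; apply: rh; move: cI; rewrite in_itv /= => /andP[/ltW h1 /ltW h2]; exact/andP.
have phi0 : phi 0 = f z by rewrite /phi scale0r addr0.
rewrite -phi0 -/(phi h).
have [h0|h0|->] := ltgtP h 0.
- have [c ch] : exists2 c, `|c| <= `|h| & phi 0 - phi h = 'D_v f (z + c *: v) * (0 - h).
    by apply: M => //; rewrite normr0.
  rewrite sub0r => Hc; have [_ ] := H c ch => He.
  rewrite -(opprB (phi 0)) Hc mulrN opprK (mulrC h) -mulrBl.
  by rewrite normrM ler_wpM2r.
- have [c ch] : exists2 c, `|c| <= `|h| & phi h - phi 0 = 'D_v f (z + c *: v) * (h - 0).
    by apply: M => //; rewrite normr0.
  rewrite subr0 => ->; have [_ ] := H c ch => He.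
  by rewrite (mulrC h) -mulrBl normrM ler_wpM2r.
- by rewrite subrr mul0r subr0 normr0 mulr0.
Qed.

Lemma derivable_expansion (f : 'rV[R]_n -> R) (z v : 'rV[R]_n) :
  derivable f z v -> forall e : R, 0 < e -> exists2 r : R, 0 < r & forall h : R, `|h| < r ->
    `|f (z + h *: v) - f z - h * 'D_v f z| <= e * `|h|.
Proof.
move=> df e e0; have /cvgrPdist_le/(_ _ e0) := df.
rewrite near_withinE => -[r r0 Hr]; exists r => // h hr.
have [->|h0] := eqVneq h 0.
  by rewrite scale0r addr0 subrr mul0r subr0 normr0 mulr0.
have : `|'D_v f z - h^-1 *: (f (h *: v + z) - f z)| <= e.
  by apply: Hr => //; rewrite /ball_ /= sub0r normrN.
rewrite -(ler_pM2r (x := `|h|)) ?normr_gt0// -normrM distrC [h *: v + z]addrC.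
by rewrite mulrBl -[_ *: _]/(h^-1 * _) mulrAC mulVf// mul1r mulrC.
Qed.

End NearGraph.

Lemma RintegralBBZ (R : realType) (D : set R) (f g h : R -> R) (r : R) :
  measurable D -> lebesgue_measure.-integrable D (EFin \o f) ->
  lebesgue_measure.-integrable D (EFin \o g) ->
  lebesgue_measure.-integrable D (EFin \o h) ->
  \int[lebesgue_measure]_(x in D) (f x - g x - r * h x) =
  \int[lebesgue_measure]_(x in D) f x - \int[lebesgue_measure]_(x in D) g x
    - r * \int[lebesgue_measure]_(x in D) h x.
Proof.
move=> mD fi gi hi; rewrite RintegralB//; last 2 first.
- exact: integrableBr.
- exact: integrable_cstM.
by rewrite RintegralB// RintegralZl.
Qed.

(** * The first variation along one coordinate *)

Section FirstVariation.
Context {R : realType} {n : nat}.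
Local Notation mu := (@lebesgue_measure R).
Local Notation intg D f := (mu.-integrable D (EFin \o (f : R -> R))).
Variables (t0 t1 : R) (b : R).
Hypotheses (t01 : t0 < t1) (b0 : 0 < b).

Local Notation I := (`[t0, t1]%classic).
Let w (t : R) := (t1 - t) `^ (b - 1).

Lemma measurable_weight : measurable_fun setT w.
Proof. by apply: (measurableT_comp (@measurable_powR R (b - 1))); exact: measurable_funB. Qed.

Lemma integrable_weight : intg I w.
Proof.
(* The added 1 covers t = t1, where the kernel is 0 but the weight is 1 if b = 1. *)
apply: (@le_integrable_fun _ _ (fun t => rlker b (t1 - t) + 1)) => //.
- by apply: measurable_funTS; exact: measurable_weight.
- move=> t; rewrite /= in_itv /= => /andP[h1 h2].
  rewrite ger0_norm ?powR_ge0//; move: h2; rewrite le_eqVlt => /predU1P[->|tt1].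
    rewrite /w subrr rlker_le0E// add0r /powR eqxx; by case: (_ == 0).
  by rewrite rlker_gt0E ?subr_gt0// lerDl.
- apply: integrableDr => //.
    apply: (@integrableS _ _ _ mu `[t0, +oo[%classic) => //.
      by move=> t; rewrite /= !in_itv /= andbT => /andP[].
    exact: integrable_rlkerB.
  apply: continuous_compact_integrable; first exact: segment_compact.
  by apply: continuous_subspaceT => x; exact: cvg_cst.
Qed.

Lemma integrable_weightM f : {within I, continuous f} -> intg I (fun t => w t * f t).
Proof.
move=> cf; have [M M0 fM] := continuous_bounded_itv cf.
have mf := measurable_continuous_itv cf.
have -> : (fun t => w t * f t) = (fun t => f t * w t) by apply/funext => t; rewrite mulrC.
by apply: (@integrable_bddM _ _ _ M) => //; exact: integrable_weight.
Qed.

Variables (L : R -> 'rV[R]_n -> 'rV[R]_n -> R) (x y : R -> 'rV[R]_n).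
Variable U : set (R * 'rV[R]_n * 'rV[R]_n).
Let D := U `&` [set p | p.1.1 \in `[t0, t1]].
Hypotheses (oU : open U) (Uxy : {in `[t0, t1], forall t, U (t, x t, y t)}).
Hypotheses (cx : {within I, continuous x}) (cy : {within I, continuous y}).
Hypothesis grad : forall p, D p ->
           has_gradient (fun z => L p.1.1 z p.2) p.1.2 /\
           has_gradient (fun z => L p.1.1 p.1.2 z) p.2.
Hypotheses (cL : {within D, continuous (fun p => L p.1.1 p.1.2 p.2)})
  (cLx : {within D, continuous (fun p => gradx L p.1.1 p.1.2 p.2)})
  (cLy : {within D, continuous (fun p => grady L p.1.1 p.1.2 p.2)}).

Lemma within_comp_graph (V : topologicalType) (G : R * 'rV[R]_n * 'rV[R]_n -> V)
    (X Y : R -> 'rV[R]_n) : {within D, continuous G} ->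
  {within I, continuous X} -> {within I, continuous Y} ->
  {in `[t0, t1], forall t, U (t, X t, Y t)} ->
  {within I, continuous (fun t => G (t, X t, Y t))}.
Proof.
move=> /subspace_continuousP cG /subspace_continuousP cX /subspace_continuousP cY UXY.
apply/subspace_continuousP => t tI.
apply: (@cvg_comp _ _ _ (fun t => (t, X t, Y t)) G _ (within D (nbhs (t, X t, Y t)))).
  have h : (fun t => (t, X t, Y t)) @ within I (nbhs t) --> (t, X t, Y t).
    apply: (@cvg_pair _ _ _ _ (nbhs _)); last exact: cY.
    apply: (@cvg_pair _ _ _ _ (nbhs _)); last exact: cX.
    exact: cvg_within.
  move=> B; rewrite /within /= => /h /= hB.
  have hI : within I (nbhs t) (fun s => I s) by exact: withinT.
  have hB' : within I (nbhs t) (fun s => D (s, X s, Y s) -> B (s, X s, Y s)) := hB.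
  have FF : Filter (within I (nbhs t)) by exact: within_filter.
  have : within I (nbhs t) (fun s => B (s, X s, Y s)); last by [].
  apply: filterS2 hB' hI => s hs sI; apply: hs; split => //=.
  exact: UXY.
by apply: cG; split => //; exact: UXY.
Qed.

Lemma integrable_lagrangian X Y : {within I, continuous X} -> {within I, continuous Y} ->
  {in `[t0, t1], forall t, U (t, X t, Y t)} -> intg I (fun t => w t * L t (X t) (Y t)).
Proof.
move=> cX cY UXY; apply: integrable_weightM.
exact: (within_comp_graph cL cX cY UXY).
Qed.

Variable i : 'I_n.
Let ei : 'rV[R]_n := delta_mx 0 i.
Variables (eta g : R -> R).
Hypotheses (ceta : {within I, continuous eta}) (cg : {within I, continuous g}).
Let Lxi t := gradx L t (x t) (y t) 0 i.
Let Lyi t := grady L t (x t) (y t) 0 i.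

Lemma within_continuousZ (f : R -> R) (c : R) (v : 'rV[R]_n) : {within I, continuous f} ->
  {within I, continuous (fun t => (c * f t) *: v)}.
Proof.
move=> cf; apply: (@within_continuous_comp _ _ _ I f (fun r : R => (c * r) *: v)) => // r _.
apply: (@continuousZl _ _ _ (fun r => c * r)).
by apply: cvgM; [exact: cvg_cst|exact: cvg_id].
Qed.

(** The increment is split at the point where only y has moved. Each leg is a one-dimensional mean
    value estimate, so the x-derivative must be controlled with y already displaced. *)
Lemma lagrangian_expansion (e : R) : 0 < e -> exists2 r : R, 0 < r &
  forall eps : R, `|eps| < r -> forall t, t \in `[t0, t1] ->
   U (t, x t + (eps * eta t) *: ei, y t + (eps * g t) *: ei) /\
   `|L t (x t + (eps * eta t) *: ei) (y t + (eps * g t) *: ei) - L t (x t) (y t)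
     - eps * (eta t * Lxi t + g t * Lyi t)| <= e * `|eps|.
Proof.
move=> e0.
have [M1 M10 HM1] := continuous_bounded_itv ceta.
have [M2 M20 HM2] := continuous_bounded_itv cg.
pose M := M1 + M2; have M0 : 0 < M by exact: addr_gt0.
have e'0 : 0 < e / M by exact: divr_gt0.
have cLxi : {within D, continuous (fun p => gradx L p.1.1 p.1.2 p.2 0 i)}.
  exact: (@within_continuous_coord _ _ _ D (fun p => gradx L p.1.1 p.1.2 p.2) i cLx).
have cLyi : {within D, continuous (fun p => grady L p.1.1 p.1.2 p.2 0 i)}.
  exact: (@within_continuous_coord _ _ _ D (fun p => grady L p.1.1 p.1.2 p.2) i cLy).
have [r1 r10 H1] := uniform_near_graph t01 oU cLxi cx cy Uxy e'0.
have [r2 r20 H2] := uniform_near_graph t01 oU cLyi cx cy Uxy e'0.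
(* With |eps| < r0 / (M N), every displacement k ei with |k| <= |eps| M stays below both radii. [N]
   is a positive number above the norm of [ei]. *)
pose N := `|ei| + 1; have N0 : 0 < N by rewrite ltr_wpDl.
pose r0 := Num.min r1 r2; have r00 : 0 < r0 by rewrite lt_min r10 r20.
exists (r0 / (M * N)); first by rewrite divr_gt0// mulr_gt0.
move=> eps; rewrite ltr_pdivlMr ?mulr_gt0// => epsr t tI.
have small (k : R) : `|k| <= `|eps| * M -> `|k *: ei| < r0.
  move=> hk; apply: le_lt_trans epsr; rewrite normrZ mulrA.
  by apply: ler_pM => //; rewrite /N lerDl.
have small1 k : `|k| <= `|eps| * M -> `|k *: ei| < r1.
  by move=> /small /lt_le_trans; apply; rewrite ge_min lexx.
have small2 k : `|k| <= `|eps| * M -> `|k *: ei| < r2.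
  by move=> /small /lt_le_trans; apply; rewrite ge_min lexx orbT.
have he : `|eps * eta t| <= `|eps| * M.
  by rewrite normrM ler_wpM2l// (le_trans (HM1 t tI))// lerDl ltW.
have hg : `|eps * g t| <= `|eps| * M.
  by rewrite normrM ler_wpM2l// (le_trans (HM2 t tI))// lerDr ltW.
have z1 : `|0 : 'rV[R]_n| < r1 by rewrite normr0.
have z2 : `|0 : 'rV[R]_n| < r2 by rewrite normr0.
split; first exact: (H1 t _ _ tI (small1 _ he) (small1 _ hg)).1.
have A1 : `|L t (x t + (eps * eta t) *: ei) (y t + (eps * g t) *: ei) -
    L t (x t) (y t + (eps * g t) *: ei) - (eps * eta t) * Lxi t| <= e / M * `|eps * eta t|.
  apply: (@MVT_direction _ _ (fun z => L t z (y t + (eps * g t) *: ei))) => k hk.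
  have hk' := le_trans hk he.
  have [Uk Hk] := H1 t _ _ tI (small1 _ hk') (small1 _ hg).
  split; first by have := (grad (conj Uk tI)).1 i.
  have : 'D_ei (fun z => L t z (y t + (eps * g t) *: ei)) (x t + k *: ei) =
         gradx L t (x t + k *: ei) (y t + (eps * g t) *: ei) 0 i by rewrite /gradx mxE.
  by move=> ->; exact: ltW.
have A2 : `|L t (x t) (y t + (eps * g t) *: ei) -
    L t (x t) (y t) - (eps * g t) * Lyi t| <= e / M * `|eps * g t|.
  apply: (@MVT_direction _ _ (fun z => L t (x t) z)) => k hk.
  have hk' := le_trans hk hg.
  have := H2 t 0 _ tI z2 (small2 _ hk'); rewrite addr0 => -[Uk Hk].
  split; first by have := (grad (conj Uk tI)).2 i.
  have : 'D_ei (fun z => L t (x t) z) (y t + k *: ei) =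
         grady L t (x t) (y t + k *: ei) 0 i by rewrite /grady mxE.
  by move=> ->; exact: ltW.
rewrite (_ : _ - _ = (L t (x t + (eps * eta t) *: ei) (y t + (eps * g t) *: ei) -
    L t (x t) (y t + (eps * g t) *: ei) - (eps * eta t) * Lxi t) +
    (L t (x t) (y t + (eps * g t) *: ei) -
    L t (x t) (y t) - (eps * g t) * Lyi t)); last by ring.
apply: (le_trans (ler_normD _ _)); apply: (le_trans (lerD A1 A2)).
rewrite -mulrDr -mulrA (ler_pM2l e0) ler_pdivrMl// !normrM -mulrDr mulrC.
by rewrite ler_wpM2r// lerD ?HM1 ?HM2.
Qed.

Variable l : 'rV[R]_n -> R.
Hypothesis dl : derivable l (x t1) ei.

Let J (eps : R) := \int[mu]_(t in I) (w t *
    L t (x t + (eps * eta t) *: ei) (y t + (eps * g t) *: ei)) +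
    l (x t1 + (eps * eta t1) *: ei).

(** [A] is the derivative of [J] at 0, in the form |J eps - J 0 - eps A| <= e |eps| for small eps.
    Minimality at eps = r and at eps = - r then encloses [A] between - e and e. *)
Lemma first_variation (r0 : R) : 0 < r0 -> (forall eps, `|eps| < r0 -> J 0 <= J eps) ->
  \int[mu]_(t in I) (w t * (eta t * Lxi t + g t * Lyi t)) + eta t1 * 'D_ei l (x t1) = 0.
Proof.
move=> r00 Jmin; set A := LHS.
have Wint := integrable_weight.
pose W := \int[mu]_(t in I) w t.
have W0 : 0 <= W by apply: Rintegral_ge0 => t _; exact: powR_ge0.
have [M1 M10 HM1] := continuous_bounded_itv ceta.
have cLxi : {within I, continuous Lxi}.
  by apply: within_continuous_coord; exact: (within_comp_graph cLx cx cy Uxy).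
have cLyi : {within I, continuous Lyi}.
  by apply: within_continuous_coord; exact: (within_comp_graph cLy cx cy Uxy).
have iA : intg I (fun t => w t * (eta t * Lxi t + g t * Lyi t)).
  apply: integrable_weightM => t.
  by apply: cvgD; apply: cvgM; [exact: ceta|exact: cLxi|exact: cg|exact: cLyi].
suff H : forall e : R, 0 < e -> `|A| <= e.
  apply/eqP; rewrite -normr_le0; apply/ler_addgt0Pl => e e0; rewrite addr0; exact: H.
move=> e e0.
(* Half of [e] goes to the integral, whose weight has total mass [W], and half to the terminal term,
   where |eta t1| <= M1. [W + 1] is positive without further argument. *)
pose e1 := e / (2 * (W + 1)); pose e2 := e / (2 * M1).
have W1 : 0 < W + 1 by rewrite ltr_wpDl.
have e10 : 0 < e1 by rewrite divr_gt0// mulr_gt0.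
have e20 : 0 < e2 by rewrite divr_gt0// mulr_gt0.
have [r1 r10 H1] := lagrangian_expansion e10.
have [r2 r20 H2] := derivable_expansion dl e20.
have r2M : 0 < r2 / M1 by exact: divr_gt0.
have key eps : `|eps| < r1 -> `|eps| < r2 / M1 -> `|J eps - J 0 - eps * A| <= e * `|eps|.
  move=> er1 er2.
  have He t (tI : t \in `[t0, t1]) := H1 eps er1 t tI.
  (* The perturbed graph stays in [U], so the integrand is a continuous function times the weight
     and linearity of the integral is legitimate. *)
  have i1 : intg I (fun t => w t * L t (x t + (eps * eta t) *: ei) (y t + (eps * g t) *: ei)).
    apply: integrable_lagrangian.
    - by apply: within_continuousD => //; exact: within_continuousZ.
    - by apply: within_continuousD => //; exact: within_continuousZ.
    - by move=> t tI; exact: (He t tI).1.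
  have i0 : intg I (fun t => w t * L t (x t) (y t)) by exact: integrable_lagrangian.
  have E0 : J 0 = \int[mu]_(t in I) (w t * L t (x t) (y t)) + l (x t1).
    rewrite /J mul0r scale0r addr0; congr (_ + _).
    by apply: eq_Rintegral => t _; rewrite !mul0r !scale0r !addr0.
  pose Q t := L t (x t + (eps * eta t) *: ei) (y t + (eps * g t) *: ei) - L t (x t) (y t)
     - eps * (eta t * Lxi t + g t * Lyi t).
  have EQ : \int[mu]_(t in I) (w t * Q t) =
     \int[mu]_(t in I) (w t * L t (x t + (eps * eta t) *: ei) (y t + (eps * g t) *: ei))
     - \int[mu]_(t in I) (w t * L t (x t) (y t))
     - eps * \int[mu]_(t in I) (w t * (eta t * Lxi t + g t * Lyi t)).
    rewrite -RintegralBBZ//.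
    by apply: eq_Rintegral => t _; rewrite /Q; ring.
  have iQ : intg I (fun t => w t * Q t).
    have -> : (fun t => w t * Q t) = (fun t =>
      (w t * L t (x t + (eps * eta t) *: ei) (y t + (eps * g t) *: ei)
       - w t * L t (x t) (y t)) - eps * (w t * (eta t * Lxi t + g t * Lyi t))).
      by apply/funext => t; rewrite /Q; ring.
    by apply: integrableBr => //; [exact: integrableBr|exact: integrable_cstM].
  have BQ : `|\int[mu]_(t in I) (w t * Q t)| <= e1 * `|eps| * W.
    rewrite /W -RintegralZl//; apply: le_normr_Rintegral_dom => //.
      exact: integrable_cstM.
    move=> t tI; rewrite normrM ger0_norm ?powR_ge0// mulrC ler_wpM2r ?powR_ge0//.
    exact: (He t tI).2.
  have Bl : `|l (x t1 + (eps * eta t1) *: ei) - l (x t1) - (eps * eta t1) * 'D_ei l (x t1)|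
      <= e2 * (`|eps| * M1).
    have h1 : `|eps * eta t1| <= `|eps| * M1.
      by rewrite normrM ler_wpM2l// HM1// in_itv /= lexx andbT ltW.
    apply: (le_trans (H2 _ _)); last by rewrite ler_wpM2l// ltW.
    by apply: (le_lt_trans h1); rewrite -ltr_pdivlMr.
  rewrite (_ : J eps - J 0 - eps * A = \int[mu]_(t in I) (w t * Q t) +
    (l (x t1 + (eps * eta t1) *: ei) - l (x t1) - (eps * eta t1) * 'D_ei l (x t1))); last first.
    by rewrite EQ E0 /J /A; ring.
  apply: (le_trans (ler_normD _ _)); apply: (le_trans (lerD BQ Bl)).
  have -> : e2 * (`|eps| * M1) = e / 2 * `|eps|.
    by rewrite /e2; field; rewrite gt_eqF.
  have : e1 * `|eps| * W <= e / 2 * `|eps|.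
    have -> : e1 * `|eps| * W = e / 2 * `|eps| * (W / (W + 1)).
      by rewrite /e1; field; rewrite gt_eqF.
    rewrite ler_piMr ?mulr_ge0 ?divr_ge0 ?(ltW e0)//.
    by rewrite ler_pdivrMr// mul1r lerDl.
  by move=> h; rewrite {2}(splitr e) mulrDl; exact: lerD.
pose r := Num.min r0 (Num.min r1 (r2 / M1)) / 2.
have m0 : 0 < Num.min r0 (Num.min r1 (r2 / M1)) by rewrite !lt_min r00 r10 r2M.
have rp : 0 < r by rewrite divr_gt0.
have rm : r < Num.min r0 (Num.min r1 (r2 / M1)) by rewrite /r; lra.
move: rm; rewrite !lt_min => /andP[rr0 /andP[rr1 rr2]].
have nr : `|r| = r by rewrite gtr0_norm.
have nr' : `|- r| = r by rewrite normrN.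
have K1 : J 0 <= J r by apply: Jmin; rewrite nr.
have K2 : J 0 <= J (- r) by apply: Jmin; rewrite nr'.
have := key r; rewrite nr => /(_ rr1 rr2); rewrite ler_norml => /andP[k1 k2].
have := key (- r); rewrite nr' => /(_ rr1 rr2); rewrite ler_norml => /andP[k3 k4].
rewrite ler_norml; apply/andP; split; rewrite -(ler_pM2l rp); lra.
Qed.

End FirstVariation.

(** * The fundamental lemma, behaviour at t1, and fractional integration by parts *)

Section EulerLagrange.
Context {R : realType}.
Local Notation mu := (@lebesgue_measure R).
Local Notation intg D f := (mu.-integrable D (EFin \o (f : R -> R))).
Variables (t0 t1 : R).
Hypothesis t01 : t0 < t1.
Local Notation I := (`[t0, t1]%classic).

(* P is tested against a tent function centred at t. *)
Lemma vanishing_of_orthogonal (P : R -> R) (t : R) : t0 <= t -> t < t1 ->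
  P @ within I (nbhs t) --> P t ->
  (forall g : R -> R, {within I, continuous g} -> intg I (fun s => g s * P s)) ->
  (forall g : R -> R, {within I, continuous g} -> \int[mu]_(s in I) (g s * P s) = 0) ->
  P t = 0.
Proof.
move=> t0t tt1 cP iP orth; apply/eqP; apply: contraT => Pt0; exfalso.
set c := P t in Pt0.
have c2 : 0 < c ^+ 2 by rewrite exprn_even_gt0.
have cn : 0 < `|c| / 2 by rewrite divr_gt0// normr_gt0.
have /cvgrPdist_lt/(_ _ cn) := cP; rewrite near_withinE => -[d d0 Hd].
pose r := Num.min d (t1 - t).
have r0 : 0 < r by rewrite lt_min d0 subr_gt0.
have rd : r <= d by rewrite ge_min lexx.
have rt : r <= t1 - t by rewrite ge_min lexx orbT.
pose g s := Num.max 0 (r - `|t - s|).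
have g0 s : 0 <= g s by rewrite le_max lexx.
have cg : {within I, continuous g}.
  apply: continuous_subspaceT => s.
  apply: (@continuous_max R R (fun=> 0 : R^o) (fun s => r - `|t - s| : R^o) s).
    exact: cvg_cst.
  apply: cvgB; first exact: cvg_cst.
  apply: cvg_norm; apply: cvgB; [exact: cvg_cst|exact: cvg_id].
have ig : intg I g.
  by apply: continuous_compact_integrable => //; exact: segment_compact.
(* On the support of the tent [P] is within |c| / 2 of [c], so c P is at least c^2 / 2. Multiplying
   by [c] treats both signs of P t together. *)
have low s : I s -> (c ^+ 2 / 2) * g s <= c * (g s * P s).
  move=> sI; have [h|h] := leP r `|t - s|.
    have -> : g s = 0 by apply/max_idPl; rewrite subr_le0.
    by rewrite mul0r !mulr0.
  have := Hd s (lt_le_trans h rd) sI; rewrite -/c => hs.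
  rewrite mulrCA [leLHS]mulrC ler_wpM2l//.
  have : c * (c - P s) <= c ^+ 2 / 2.
    apply: (le_trans (ler_norm _)); rewrite normrM -[c ^+ 2]real_normK ?num_real//.
    by rewrite expr2 -mulrA ler_wpM2l// ltW.
  rewrite mulrBr -expr2 => hh; move: (c * P s) (c ^+ 2) hh => u v hh; lra.
have E0 : \int[mu]_(s in I) (c * (g s * P s)) = 0.
  by rewrite RintegralZl ?orth ?mulr0//; exact: iP.
have : c ^+ 2 / 2 * \int[mu]_(s in I) g s <= 0.
  rewrite -E0 -RintegralZl//; apply: le_Rintegral => //.
    exact: integrable_cstM.
  by apply: integrable_cstM => //; exact: iP.
rewrite pmulr_rle0 ?divr_gt0// leNgt => /negP; apply.
have r2 : 0 < r / 2 by rewrite divr_gt0.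
(* The right half of the tent: t < t1 leaves room on that side even when t = t0, and there [g] is at
   least r / 2. *)
pose K : set R := `[t, t + r / 2]%classic.
have KI : K `<=` I.
  move=> s; rewrite /K /= !in_itv /= => /andP[h1 h2]; apply/andP; split; lra.
have mK : mu (K : set R) = (r / 2)%:E.
  by rewrite /K lebesgue_measure_itv /= lte_fin ltrDl r2 -EFinB addrC addKr.
have cK : intg K (fun=> r / 2).
  apply: continuous_compact_integrable; first exact: segment_compact.
  by apply: continuous_subspaceT => x; exact: cvg_cst.
have mKm : measurable K by exact: measurable_itv.
apply: (@lt_le_trans _ _ (\int[mu]_(s in K) (r / 2))).
  rewrite Rintegral_cst// mulr_gt0//.
  by rewrite (_ : fine _ = r / 2) // -[RHS]/(fine (r / 2)%:E) -mK.
apply: (@le_trans _ _ (\int[mu]_(s in K) g s)).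
  apply: le_Rintegral => //; first exact: integrableS ig.
  move=> s; rewrite /K /= in_itv /= => /andP[h1 h2]; rewrite /g le_max.
  by apply/orP; right; rewrite ler0_norm ?subr_le0//; lra.
rewrite (Rintegral_itvE `[t, t + r / 2]) (Rintegral_itvE `[t0, t1]).
apply: le_Rintegral => //.
- by apply/integrable_itvP; exact: integrableS ig.
- exact/integrable_itvP.
move=> s _; rewrite ler_wpM2r// ler_nat.
by have [/KI /= ->//|] := boolP (s \in `[t, t + r / 2]).
Qed.

(** Passes to t1 from estimates known only before t1. It will serve twice: to kill the gradient of
    l, and to extend the equation to t1. *)
Lemma vanishing_at_end (Q : R -> R) (C p : R) : 0 < p ->
  Q @ within I (nbhs t1) --> Q t1 ->
  (forall s, t0 <= s -> s < t1 -> `|Q s| <= C * (t1 - s) `^ p) -> Q t1 = 0.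
Proof.
move=> p0 cQ QC; apply/eqP; rewrite -normr_le0; apply/ler_addgt0Pl => e e0.
rewrite addr0; have e2 : 0 < e / 2 by rewrite divr_gt0.
have /cvgrPdist_lt/(_ _ e2) := cQ; rewrite near_withinE => -[d d0 Hd].
have C1 : 0 < `|C| + 1 by rewrite ltr_wpDl.
have [d' d'0 Hd'] := powR_small p0 (divr_gt0 e2 C1).
pose m := Num.min (Num.min d d') (t1 - t0).
have m0 : 0 < m by rewrite !lt_min d0 d'0 subr_gt0.
have md : m <= d by rewrite /m !ge_min lexx.
have md' : m <= d' by rewrite /m !ge_min lexx orbT.
have mt : m <= t1 - t0 by rewrite /m !ge_min lexx orbT.
pose s := t1 - m / 2.
have t0s : t0 <= s by rewrite /s; lra.
have st : s < t1 by rewrite /s; lra.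
have ms : t1 - s = m / 2 by rewrite /s; lra.
have h1 : `|Q t1 - Q s| < e / 2.
  apply: Hd => /=; last by rewrite in_itv /= t0s ltW.
  by rewrite ms gtr0_norm ?divr_gt0//; lra.
have h2 : `|Q s| <= e / 2.
  apply: (le_trans (QC s t0s st)).
  have := Hd' (t1 - s); rewrite ms => /(_ _ _)/ltW h.
  have {}h : (m / 2) `^ p <= e / 2 / (`|C| + 1) by apply: h; lra.
  move: h; rewrite ler_pdivlMr// => h; apply: le_trans h.
  rewrite mulrC ler_wpM2l ?powR_ge0//; apply: (le_trans (ler_norm _)).
  by rewrite lerDl.
rewrite -(subrK (Q s) (Q t1)); apply: (le_trans (ler_normD _ _)).
by rewrite (splitr e) lerD// ltW.
Qed.

(** The case p = 0, which occurs when alpha = beta, is covered because 0 ^ 0 = 1 makes the power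
    continuous at t1. *)
Lemma powR_within_end (p : R) : 0 <= p ->
  (t1 - s) `^ p @[s --> within I (nbhs t1)] --> (t1 - t1) `^ p.
Proof.
rewrite le_eqVlt => /predU1P[<-|p0].
  under eq_fun do rewrite powRr0.
  by rewrite powRr0; exact: cvg_cst.
rewrite subrr powR0 ?gt_eqF//; apply/cvgrPdist_lt => e e0.
have [d d0 Hd] := powR_small p0 e0.
rewrite near_withinE; exists d => // s; rewrite /= => sd sI.
rewrite sub0r normrN ger0_norm ?powR_ge0//; apply: Hd.
  by move: sI; rewrite in_itv /= subr_ge0 => /andP[].
exact: le_lt_trans (ler_norm _) sd.
Qed.

Variables (a b : R).
Hypotheses (a0 : 0 < a) (a1 : a <= 1) (b0 : 0 < b).
Let wk (t : R) := rlker b (t1 - t).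

(** Once the weight is itself a kernel, b is dominated by a kernel of order beta and the Beta
    convolution formula applies to it. *)
Lemma weight_rlkerE (f : R -> R) : measurable_fun I f ->
  \int[mu]_(t in I) ((t1 - t) `^ (b - 1) * f t) = \int[mu]_(t in I) (wk t * f t).
Proof.
move=> mf; rewrite !(Rintegral_itvE `[t0, t1]).
have mc := measurable_clip mf.
have mw : measurable_fun setT (fun t : R => (t1 - t) `^ (b - 1)).
  by apply: (measurableT_comp (@measurable_powR R (b - 1))); exact: measurable_funB.
have E (h : R -> R) : (fun t => (t \in `[t0, t1])%:R * (h t * f t)) =
    (fun t => h t * clip t0 t1 f t).
  by apply/funext => t; rewrite mulrCA.
rewrite !E; apply: (@eq_Rintegral_except _ t1).
- exact: measurable_funM.
- by apply: measurable_funM => //; exact: measurable_rlkerB.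
move=> t /eqP tt1; rewrite /clip in_itv /=; case: (ltP t t1) => h.
  by rewrite /wk rlker_gt0E// subr_gt0.
by rewrite (leNgt t) lt_neqAle eq_sym tt1 h andbF mul0r !mulr0.
Qed.

Lemma Iright_weight_rlkerE (f : R -> R) s : measurable_fun I f ->
  Iright t0 t1 a (fun t => (t1 - t) `^ (b - 1) * f t) s =
  Iright t0 t1 a (fun t => wk t * f t) s.
Proof.
move=> mf; rewrite /Iright.
have mc := measurable_clip mf.
have mw : measurable_fun setT (fun t : R => (t1 - t) `^ (b - 1)).
  by apply: (measurableT_comp (@measurable_powR R (b - 1))); exact: measurable_funB.
have E (h : R -> R) : (fun t => rlker a (t - s) * clip t0 t1 (fun t => h t * f t) t) =
    (fun t => rlker a (t - s) * (h t * clip t0 t1 f t)).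
  by apply/funext => t; rewrite /clip (mulrCA _ (h t)).
rewrite !E; apply: (@eq_Rintegral_except _ t1).
- apply: measurable_funM; first exact: measurable_rlkerBr.
  exact: measurable_funM.
- apply: measurable_funM; first exact: measurable_rlkerBr.
  by apply: measurable_funM => //; exact: measurable_rlkerB.
move=> t /eqP tt1; rewrite /clip in_itv /=; case: (ltP t t1) => h.
  by rewrite /wk (@rlker_gt0E _ b)// subr_gt0.
by rewrite (leNgt t) lt_neqAle eq_sym tt1 h andbF mul0r !mulr0.
Qed.

Variables (f : R -> R) (M : R).
Hypotheses (mf : measurable_fun I f) (M0 : 0 <= M)
  (fM : forall s, s \in `[t0, t1] -> `|f s| <= M).
Let F (t : R) := clip t0 t1 (fun t => wk t * f t) t.

Lemma measurable_wkf : measurable_fun setT F.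
Proof.
apply: measurable_clip; apply: measurable_funM => //.
by apply: measurable_funTS; exact: measurable_rlkerB.
Qed.

Lemma wkf_bound t : `|F t| <= M * ((t \in `[t0, +oo[)%:R * rlker b (t1 - t)).
Proof.
rewrite /F /clip /wk normrM normr_nat normrM (ger0_norm (rlker_ge0 _ _)).
have [tI|tI] := boolP (t \in `[t0, t1]); last first.
  by rewrite mul0r !mulr_ge0 ?rlker_ge0.
rewrite (_ : t \in `[t0, +oo[); last first.
  by move: tI; rewrite !in_itv /= andbT => /andP[].
by rewrite !mul1r mulrC ler_wpM2r ?rlker_ge0// fM.
Qed.

Lemma integrable_wkf : intg setT F.
Proof.
apply: (@le_integrable_fun _ _ (fun t => M * ((t \in `[t0, +oo[)%:R * rlker b (t1 - t)))) => //.
- exact: measurable_wkf.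
- by move=> t _; exact: wkf_bound.
- by apply: integrable_cstM => //; exact/integrable_itvP/integrable_rlkerB.
Qed.

Lemma wkf_le_rlker t : `|F t| <= M * rlker b (t1 - t).
Proof.
apply: (le_trans (wkf_bound t)); rewrite ler_wpM2l// ler_piMl ?rlker_ge0//.
by case: (_ \in _).
Qed.

Lemma integrable_right s : intg setT (fun t => rlker a (t - s) * F t).
Proof.
apply: (@le_integrable_fun _ _ (fun t => M * (rlker a (t - s) * rlker b (t1 - t)))) => //.
- apply: measurable_funM; first exact: measurable_rlkerBr.
  exact: measurable_wkf.
- move=> t _; rewrite normrM (ger0_norm (rlker_ge0 _ _)) mulrCA.
  by rewrite ler_wpM2l ?rlker_ge0// wkf_le_rlker.
- by apply: integrable_cstM => //; exact: integrable_conv_rlker.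
Qed.

(** Since |F| is at most [M] times the kernel of order b, the integral is dominated by a convolution
    of kernels of orders a and b. *)
Lemma Iright_bound s : s < t1 ->
  `|Iright t0 t1 a (fun t => wk t * f t) s| <= M * Beta a b * (t1 - s) `^ (a + b - 1).
Proof.
move=> st1; rewrite -(@rlker_gt0E _ (a + b)) ?subr_gt0// -mulrA -Rintegral_conv_rlker//.
rewrite -RintegralZl//; last exact: integrable_conv_rlker.
apply: le_normr_Rintegral_dom => //.
- exact: integrable_right.
- by apply: integrable_cstM => //; exact: integrable_conv_rlker.
move=> t _; rewrite normrM (ger0_norm (rlker_ge0 _ _)) mulrCA.
by rewrite ler_wpM2l ?rlker_ge0// wkf_le_rlker.
Qed.

(* Cut the integral at a point c in ]t, t1[: on the left of c the weight is bounded,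
   so the Hoelder estimate applies; on the right the kernel is bounded near t, so
   dominated convergence applies. *)
Lemma Iright_continuous t : t < t1 ->
  {for t, continuous (Iright t0 t1 a (fun t => wk t * f t))}.
Proof.
move=> tt1; pose c := (t + t1) / 2; pose d := (t + c) / 2.
have tc : t < c by rewrite /c; lra.
have ct1 : c < t1 by rewrite /c; lra.
have td : t < d by rewrite /d; lra.
have dc : d < c by rewrite /d; lra.
pose F1 s := (s \in `]-oo, c])%:R * F s.
pose F2 s := (s \in `]c, +oo[)%:R * F s.
have mF := measurable_wkf.
have mF1 : measurable_fun setT F1 by apply: measurable_funM => //; exact: measurable_itv_indic.
have mF2 : measurable_fun setT F2 by apply: measurable_funM => //; exact: measurable_itv_indic.
have F12 s : F s = F1 s + F2 s.
  rewrite /F1 /F2 !in_itv /= andbT; have [sc|sc] := leP s c.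
    by rewrite mul1r mul0r addr0.
  by rewrite mul1r mul0r add0r.
have iF1 u : intg setT (fun s => rlker a (s - u) * F1 s).
  have -> : (fun s => rlker a (s - u) * F1 s) =
     (fun s => (s \in `]-oo, c])%:R * (rlker a (s - u) * F s)).
    by apply/funext => s; rewrite /F1 mulrCA.
  apply: (@integrable_bddM _ _ _ 1) => //.
  + exact: measurable_itv_indic.
  + by move=> s _; rewrite normr_nat; case: (_ \in _).
  + exact: integrable_right.
have iF2 u : intg setT (fun s => rlker a (s - u) * F2 s).
  have -> : (fun s => rlker a (s - u) * F2 s) =
     (fun s => (s \in `]c, +oo[)%:R * (rlker a (s - u) * F s)).
    by apply/funext => s; rewrite /F2 mulrCA.
  apply: (@integrable_bddM _ _ _ 1) => //.
  + exact: measurable_itv_indic.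
  + by move=> s _; rewrite normr_nat; case: (_ \in _).
  + exact: integrable_right.
have -> : Iright t0 t1 a (fun t => wk t * f t) = (fun u =>
    \int[mu]_s (rlker a (s - u) * F1 s) + \int[mu]_s (rlker a (s - u) * F2 s)).
  apply/funext => u; rewrite -RintegralD//; apply: eq_Rintegral => s _.
  by rewrite -mulrDr -F12.
suff c1 : {for t, continuous (fun u => \int[mu]_s (rlker a (s - u) * F1 s))}.
  apply: cvgD; first exact: c1.
  (* For u < d and s > c the argument s - u exceeds c - d, so the decreasing kernel is at most
     [rlker a (c - d)]; this gives an integrable majorant independent of u. *)
  have := @continuity_under_integral R _ _ mu (fun u s => rlker a (s - u) * F2 s) setT
     measurableT (t - 1) d.
  move=> /(_ (fun u _ => iF2 u) _ (fun s => rlker a (c - d) * `|F s|)) H.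
  apply: H.
  + apply: nearW => s _ u; rewrite inE /= in_itv /= => /andP[_ ud].
    have [sc|sc] := leP s c.
      have -> : (fun u => rlker a (s - u) * F2 s) = cst 0.
        apply/funext => v; rewrite /F2 in_itv /= andbT ltNge sc mul0r mulr0//.
      exact: cvg_cst.
    apply: cvgM; last exact: cvg_cst.
    apply: (@continuous_comp _ _ _ (fun u => s - u) (rlker a)).
      by apply: cvgB; [exact: cvg_cst|exact: cvg_id].
    by apply: continuous_rlker; lra.
  + by apply: integrable_cstM => //; exact: (integrable_norm integrable_wkf).
  + move=> u; rewrite /= in_itv /= => /andP[_ ud]; apply: nearW => s _.
    rewrite normrM (ger0_norm (rlker_ge0 _ _)) /F2 in_itv /= andbT normrM normr_nat.
    have [sc|sc] := ltP c s; last by rewrite mul0r mulr0 mulr_ge0 ?rlker_ge0.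
    rewrite mul1r ler_wpM2r//; apply: rlker_nincr => //; lra.
  + rewrite inE /= in_itv /=; apply/andP; split; lra.
(* Bounds the weight on [t0, c] for either sign of b - 1, by adding its values at both ends. *)
pose K := M * ((t1 - c) `^ (b - 1) + (t1 - t0) `^ (b - 1)).
have K0 : 0 <= K by rewrite mulr_ge0// addr_ge0 ?powR_ge0.
have N1 : (-1 : R) != 0 by rewrite oppr_eq0 oner_eq0.
(* Reflection turns the right-sided integral into a left-sided convolution starting at - c, for
   which continuity is already known. *)
pose G u := F1 (- u).
have mG : measurable_fun setT G by apply: measurableT_comp mF1 _; exact: oppr_measurable.
have GK u : `|G u| <= K * (u \in `[- c, +oo[)%:R.
  rewrite /G /F1 !in_itv /= andbT lerNl normrM normr_nat.
  have [uc|uc] := leP (- c) u; last by rewrite mul0r mulr0.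
  rewrite mul1r mulr1; have [uI|uI] := boolP (- u \in `[t0, t1]); last first.
    by rewrite /F /clip (negbTE uI) mul0r normr0.
  apply: (le_trans (wkf_le_rlker _)); rewrite ler_wpM2l//.
  have ut : t0 <= - u by move: uI; rewrite in_itv /= => /andP[].
  rewrite rlker_gt0E; last by rewrite subr_gt0; lra.
  have [b1|b1] := leP 1 b.
    rewrite -[leLHS]add0r lerD ?powR_ge0//.
    by apply: ge0_ler_powR; rewrite ?nnegrE ?subr_ge0//; lra.
  rewrite -[leLHS]addr0 lerD ?powR_ge0//.
  by apply: le0_ler_powR; lra.
have -> : (fun u => \int[mu]_s (rlker a (s - u) * F1 s)) =
   (fun v => \int[mu]_s (rlker a (v - s) * G s)) \o -%R.
  apply/funext => u /=; rewrite (Rintegral_affine 0 N1 (iF1 u)) normrN1 mul1r.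
  by apply: eq_Rintegral => s _; rewrite /G addr0 mulN1r addrC.
apply: continuous_comp; first exact: opp_continuous.
exact: (@conv_continuous _ a (- c) K).
Qed.

(** Fractional integration by parts: both sides are the double integral of F(t) rlker a (t - s)
    g(s). Integrability of the right side comes from the same Fubini argument. *)
Lemma fubini_left_right (g : R -> R) (N : R) : measurable_fun I g -> 0 <= N ->
  (forall s, s \in `[t0, t1] -> `|g s| <= N) ->
  intg I (fun s => g s * Iright t0 t1 a (fun t => wk t * f t) s) /\
  \int[mu]_(t in I) (wk t * f t * Ileft t0 t1 a g t) =
  \int[mu]_(s in I) (g s * Iright t0 t1 a (fun t => wk t * f t) s).
Proof.
move=> mg N0 gN; have mc := measurable_clip mg; have cN := clip_bounded N0 gN.
have Fq t : t1 < t -> F t = 0.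
  by move=> tt; rewrite /F /clip in_itv /= (leNgt t) tt andbF mul0r.
have fin := conv_finite a0 (ltW t01) N0 cN mc integrable_wkf Fq.
have mH := @measurable_conv_integrand R a (clip t0 t1 g) F mc measurable_wkf.
have Er s : \int[mu]_x (F x * rlker a (x - s) * clip t0 t1 g s) =
   (s \in `[t0, t1])%:R * (g s * Iright t0 t1 a (fun t => wk t * f t) s).
  rewrite mulrA -/(clip t0 t1 g s) [RHS]mulrC /Iright -RintegralZr//; last exact: integrable_right.
  by apply: eq_Rintegral => t _; rewrite (mulrC (F t)).
split.
  apply/(@integrable_itvP _ `[t0, t1]); have := integrable_Rfubini_r mH fin.
  congr (_.-integrable _ _); apply/funext => s /=; congr EFin; exact: Er.
have E := Rintegral_fubini mH fin.
rewrite !(Rintegral_itvE `[t0, t1]).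
transitivity (\int[mu]_s \int[mu]_x (F x * rlker a (x - s) * clip t0 t1 g s)); last first.
  by apply: eq_Rintegral => s _; exact: Er.
rewrite -[RHS]E; apply: eq_Rintegral => t _ /=.
rewrite mulrA -[_ * (wk t * f t)]/(F t) /Ileft -RintegralZl//; last first.
  exact: (@integrable_conv _ a t t0 N).
by apply: eq_Rintegral => s _; rewrite mulrA.
Qed.

End EulerLagrange.

(** * The scalar Euler-Lagrange equation and its limit at t1 *)

Section ScalarConditions.
Context {R : realType}.
Local Notation mu := (@lebesgue_measure R).
Local Notation intg D f := (mu.-integrable D (EFin \o (f : R -> R))).
Variables (t0 t1 a b : R).
Hypotheses (t01 : t0 < t1) (a0 : 0 < a) (a1 : a <= 1) (b0 : 0 < b).
Local Notation I := (`[t0, t1]%classic).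
Let wk (t : R) := rlker b (t1 - t).

Lemma Ileft_start f : Ileft t0 t1 a f t0 = 0.
Proof.
rewrite /Ileft (@eq_Rintegral _ _ _ _ _ (cst 0)) ?/Rintegral ?integral0// => s _.
rewrite /clip in_itv /=; have [h|h] := leP t0 s; last by rewrite mul0r mulr0.
by rewrite rlker_le0E ?subr_le0// mul0r.
Qed.

Lemma Iright_end f : Iright t0 t1 a f t1 = 0.
Proof.
rewrite /Iright (@eq_Rintegral _ _ _ _ _ (cst 0)) ?/Rintegral ?integral0// => s _.
rewrite /clip in_itv /=; have [h|h] := leP s t1; last by rewrite andbF mul0r mulr0.
by rewrite rlker_le0E ?subr_le0// mul0r.
Qed.

Lemma IleftDZ (f g : R -> R) (c t : R) : {within I, continuous f} -> {within I, continuous g} ->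
  Ileft t0 t1 a (fun s => f s + c * g s) t = Ileft t0 t1 a f t + c * Ileft t0 t1 a g t.
Proof.
move=> cf cg.
have [M M0 fM] := continuous_bounded_itv cf.
have [N N0 gN] := continuous_bounded_itv cg.
have i1 : intg setT (fun s => rlker a (t - s) * clip t0 t1 f s).
  apply: (@integrable_conv _ _ _ t0 M) => //.
    by apply: measurable_clip; exact: measurable_continuous_itv.
  by apply: clip_bounded => //; exact: ltW.
have i2 : intg setT (fun s => rlker a (t - s) * clip t0 t1 g s).
  apply: (@integrable_conv _ _ _ t0 N) => //.
    by apply: measurable_clip; exact: measurable_continuous_itv.
  by apply: clip_bounded => //; exact: ltW.
rewrite /Ileft -RintegralZl// -RintegralD//; last exact: integrable_cstM.
by apply: eq_Rintegral => s _; rewrite /clip mulrDr mulrDr; congr (_ + _); ring.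
Qed.

Variables (f h : R -> R) (c D : R).
Hypotheses (cf : {within I, continuous f}) (ch : {within I, continuous h}).
Hypothesis stationary : forall g : R -> R, {within I, continuous g} ->
  \int[mu]_(t in I) ((t1 - t) `^ (b - 1) * (c * Ileft t0 t1 a g t * f t + g t * h t))
  + c * Ileft t0 t1 a g t1 * D = 0.

Let integrable_wk (k : R -> R) : {within I, continuous k} -> intg I (fun t => wk t * k t).
Proof.
move=> ck; have [M M0 kM] := continuous_bounded_itv ck.
apply/(@integrable_itvP _ `[t0, t1]).
by apply: (@integrable_wkf _ t0 t1 b b0 k M) => //; [exact: measurable_continuous_itv|exact: ltW].
Qed.

(** The application takes c = 1 / Gamma a, with [f], [h] and [D] the i-th components of L_x, L_y and
    of the gradient of l. *)
Let P (s : R) := c * Iright t0 t1 a (fun t => wk t * f t) s + wk s * h s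
    + c * D * rlker a (t1 - s).

(** The terminal term is an integral against [g] too, because [Ileft t0 t1 a g t1] integrates g(s)
    rlker a (t1 - s). Stationarity thus says that every continuous [g] is orthogonal to [P]. *)
Lemma euler_lagrange_rlker t : t0 <= t -> t < t1 -> P t = 0.
Proof.
move=> t0t tt1.
have [Mf Mf0 fM] := continuous_bounded_itv cf.
have mf := measurable_continuous_itv cf.
have mh := measurable_continuous_itv ch.
have fub (g : R -> R) (cg : {within I, continuous g}) :
  intg I (fun s => g s * Iright t0 t1 a (fun t => wk t * f t) s) /\
  \int[mu]_(t in I) (wk t * f t * Ileft t0 t1 a g t) =
  \int[mu]_(s in I) (g s * Iright t0 t1 a (fun t => wk t * f t) s).
  have [N N0 gN] := continuous_bounded_itv cg.
  apply: (fubini_left_right t01 a0 b0 mf (ltW Mf0) fM (measurable_continuous_itv cg) (ltW N0) gN).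
have i3 (g : R -> R) (cg : {within I, continuous g}) : intg I (fun s => rlker a (t1 - s) * g s).
  have [N N0 gN] := continuous_bounded_itv cg.
  apply/(@integrable_itvP _ `[t0, t1]).
  have := @integrable_conv _ a t1 t0 N (clip t0 t1 g) a0
    (measurable_clip (measurable_continuous_itv cg)) (clip_bounded (ltW N0) gN).
  by congr (_.-integrable _ _); apply/funext => s /=; rewrite /clip mulrCA.
have cM (g k : R -> R) : {within I, continuous g} -> {within I, continuous k} ->
    {within I, continuous (fun s => g s * k s)}.
  by move=> cg ck s; apply: cvgM; [exact: cg|exact: ck].
have decomp (g : R -> R) s : g s * P s = c * (g s * Iright t0 t1 a (fun t => wk t * f t) s)
    + wk s * (g s * h s) + c * D * (rlker a (t1 - s) * g s).
  by rewrite /P; ring.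
have iT (g : R -> R) (cg : {within I, continuous g}) :
   intg I (fun s => c * (g s * Iright t0 t1 a (fun t => wk t * f t) s) + wk s * (g s * h s)).
  apply: integrableDr => //; last by apply: integrable_wk; exact: cM.
  by apply: integrable_cstM => //; exact: (fub g cg).1.
have cI (g : R -> R) : {within I, continuous g} -> {within I, continuous (Ileft t0 t1 a g)}.
  move=> cg; have [N N0 gN] := continuous_bounded_itv cg.
  apply: continuous_subspaceT.
  exact: (Ileft_continuous a0 a1 (ltW N0) (measurable_continuous_itv cg) gN).
apply: (@vanishing_of_orthogonal _ t0 t1 P t t0t tt1).
- apply: cvgD; first apply: cvgD.
  + apply: cvgM; first exact: cvg_cst.
    apply: cvg_within_filter.
    exact: (Iright_continuous a0 a1 b0 mf (ltW Mf0) fM tt1).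
  + apply: cvgM.
      apply: cvg_within_filter; apply: (@continuous_comp _ _ _ (fun s => t1 - s) (rlker b)).
        by apply: cvgB; [exact: cvg_cst|exact: cvg_id].
      by apply: continuous_rlker; rewrite subr_gt0.
    have /subspace_continuousP := ch; apply.
    by rewrite /= in_itv /= t0t ltW.
  + apply: cvgM; first exact: cvg_cst.
    apply: cvg_within_filter; apply: (@continuous_comp _ _ _ (fun s => t1 - s) (rlker a)).
      by apply: cvgB; [exact: cvg_cst|exact: cvg_id].
    by apply: continuous_rlker; rewrite subr_gt0.
- move=> g cg; rewrite (funext (decomp g)).
  by apply: integrableDr => //; [exact: iT|apply: integrable_cstM => //; exact: i3].
move=> g cg; rewrite -[RHS](stationary cg).
rewrite (funext (decomp g)).
rewrite RintegralD//; [|exact: iT|by apply: integrable_cstM => //; exact: i3].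
have iR := (fub g cg).1.
have iG : intg I (fun s => wk s * (g s * h s)) by apply: integrable_wk; exact: cM.
rewrite RintegralD//; last exact: integrable_cstM.
rewrite RintegralZl// RintegralZl//; last exact: i3.
rewrite -(fub g cg).2.
rewrite [in RHS](@weight_rlkerE _ t0 t1 b (fun t => c * Ileft t0 t1 a g t * f t + g t * h t)); last first.
  apply: measurable_funD; apply: measurable_funM => //.
  - by apply: measurable_funM => //; exact: measurable_continuous_itv (cI g cg).
  - exact: measurable_continuous_itv.
have iL : intg I (fun t => wk t * f t * Ileft t0 t1 a g t).
  have := integrable_wk (cM _ _ cf (cI g cg)).
  by congr (_.-integrable _ _); apply/funext => s /=; rewrite mulrA.
have -> : \int[mu]_(t in I) (rlker b (t1 - t) * (c * Ileft t0 t1 a g t * f t + g t * h t)) =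
   c * \int[mu]_(t in I) (wk t * f t * Ileft t0 t1 a g t) + \int[mu]_(t in I) (wk t * (g t * h t)).
  rewrite -RintegralZl// -RintegralD//; last exact: integrable_cstM.
  by apply: eq_Rintegral => s _; rewrite /wk; ring.
congr (_ + _); rewrite [RHS]mulrAC; congr (_ * _).
rewrite /Ileft (Rintegral_itvE `[t0, t1]).
by apply: eq_Rintegral => s _; rewrite /clip mulrCA.
Qed.

Let Ir := Iright t0 t1 a (fun t => (t1 - t) `^ (b - 1) * f t).

Lemma euler_lagrange t : t0 <= t -> t < t1 ->
  c * Ir t + (t1 - t) `^ (b - 1) * h t + c * D * (t1 - t) `^ (a - 1) = 0.
Proof.
move=> t0t tt1; rewrite -[RHS](euler_lagrange_rlker t0t tt1) /P /wk.
rewrite !rlker_gt0E ?subr_gt0// /Ir Iright_weight_rlkerE//.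
exact: measurable_continuous_itv.
Qed.

Lemma Ir_bound : exists2 C, 0 <= C & forall t, t < t1 ->
  `|Ir t| <= C * (t1 - t) `^ (a + b - 1).
Proof.
have [M M0 fM] := continuous_bounded_itv cf.
have mf := measurable_continuous_itv cf.
exists (M * Beta a b).
  rewrite mulr_ge0 ?(ltW M0)//; apply: Rintegral_ge0 => s _.
  by rewrite mulr_ge0 ?rlker_ge0.
move=> t tt1; rewrite /Ir Iright_weight_rlkerE//.
exact: (Iright_bound a0 b0 mf (ltW M0) fM tt1).
Qed.

(** Before t1 this is the Euler-Lagrange equation times (t1 - t)^(1-b). At t1 the first term is 0
    because its integral is; the other two are continuous there and, before t1, are bounded by a
    multiple of (t1 - t)^a. *)
Lemma condition_beta_le_alpha t : b <= a -> t \in `[t0, t1] ->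
  (t1 - t) `^ (1 - b) * (c * Ir t) + h t + (t1 - t) `^ (a - b) * c * D = 0.
Proof.
move=> ba; have [C C0 HC] := Ir_bound.
have EL s : t0 <= s -> s < t1 ->
    (t1 - s) `^ (1 - b) * (c * Ir s) + h s + (t1 - s) `^ (a - b) * c * D = 0.
  move=> t0s st; have u0 : t1 - s != 0 by rewrite subr_eq0 gt_eqF.
  have E1 : (t1 - s) `^ (1 - b) * (t1 - s) `^ (b - 1) = 1.
    by rewrite -powRD ?u0 ?implybT// (_ : 1 - b + (b - 1) = 0) ?powRr0//; ring.
  have E2 : (t1 - s) `^ (1 - b) * (t1 - s) `^ (a - 1) = (t1 - s) `^ (a - b).
    by rewrite -powRD ?u0 ?implybT//; congr (_ `^ _); ring.
  have := euler_lagrange t0s st; move: E1 E2.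
  move: ((t1 - s) `^ (1 - b)) (_ `^ (b - 1)) (_ `^ (a - 1)) (_ `^ (a - b)) => p q r v.
  move: (Ir s) (h s) => ir hs E1 <- EL; rewrite -[hs]mul1r -E1.
  by rewrite -[RHS](mulr0 p) -EL; ring.
rewrite in_itv /= => /andP[t0t]; rewrite le_eqVlt => /predU1P[->|tt1]; last exact: EL.
rewrite /Ir Iright_end !mulr0 add0r.
(* The exponent a is the sum of 1 - b, from the multiplier, and a + b - 1, from the bound on the
   right-sided integral. *)
apply: (@vanishing_at_end _ t0 t1 t01 (fun s => h s + (t1 - s) `^ (a - b) * c * D) (`|c| * C) a a0).
  apply: cvgD.
    have /subspace_continuousP := ch; apply.
    by rewrite /= in_itv /= lexx ltW.
  apply: cvgM; last exact: cvg_cst.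
  apply: cvgM; last exact: cvg_cst.
  by apply: powR_within_end; rewrite subr_ge0.
move=> s t0s st; have u0 : t1 - s != 0 by rewrite subr_eq0 gt_eqF.
have := EL s t0s st; rewrite -addrA => /eqP; rewrite addrC addr_eq0 => /eqP ->.
rewrite normrN !normrM (ger0_norm (powR_ge0 _ _)) mulrCA -mulrA ler_wpM2l//.
have -> : (t1 - s) `^ a = (t1 - s) `^ (1 - b) * (t1 - s) `^ (a + b - 1).
  by rewrite -powRD ?u0 ?implybT//; congr (_ `^ _); ring.
by rewrite mulrCA ler_wpM2l ?powR_ge0// HC.
Qed.

(** After multiplication by (t1 - t)^(1-a) the l-term is the constant c D, equal to minus the other
    two terms, which tend to 0 at t1. With D = 0 the equation at t1 reads 0 = 0, since b - a > 0. *)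
Lemma condition_alpha_lt_beta : a < b -> c != 0 -> D = 0 /\
  forall t, t \in `[t0, t1] ->
  (t1 - t) `^ (1 - a) * (c * Ir t) + (t1 - t) `^ (b - a) * h t = 0.
Proof.
move=> ab c0; have [C C0 HC] := Ir_bound.
have [M M0 hM] := continuous_bounded_itv ch.
have EL s : t0 <= s -> s < t1 ->
    (t1 - s) `^ (1 - a) * (c * Ir s) + (t1 - s) `^ (b - a) * h s + c * D = 0.
  move=> t0s st; have u0 : t1 - s != 0 by rewrite subr_eq0 gt_eqF.
  have E1 : (t1 - s) `^ (1 - a) * (t1 - s) `^ (a - 1) = 1.
    by rewrite -powRD ?u0 ?implybT// (_ : 1 - a + (a - 1) = 0) ?powRr0//; ring.
  have E2 : (t1 - s) `^ (1 - a) * (t1 - s) `^ (b - 1) = (t1 - s) `^ (b - a).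
    by rewrite -powRD ?u0 ?implybT//; congr (_ `^ _); ring.
  have := euler_lagrange t0s st; move: E1 E2.
  move: ((t1 - s) `^ (1 - a)) (_ `^ (b - 1)) (_ `^ (a - 1)) (_ `^ (b - a)) => p q r v.
  move: (Ir s) (h s) => ir hs E1 <- EL; rewrite -[c * D]mul1r -E1.
  by rewrite -[RHS](mulr0 p) -EL; ring.
have D0 : D = 0.
  suff /eqP : c * D = 0 by rewrite mulf_eq0 (negbTE c0) => /eqP.
  have p0 : 0 < b - a by rewrite subr_gt0.
  (* The integral term is of order (t1 - s)^b; writing it as (t1 - s)^a (t1 - s)^(b-a) and bounding
     the first factor by (t1 - t0)^a gives it the exponent of the L_y term. *)
  apply: (@vanishing_at_end _ t0 t1 t01 (fun=> c * D)
    (`|c| * C * (t1 - t0) `^ a + M) (b - a) p0); first exact: cvg_cst.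
  move=> s t0s st; have u0 : t1 - s != 0 by rewrite subr_eq0 gt_eqF.
  have sI : s \in `[t0, t1] by rewrite in_itv /= t0s ltW.
  have := EL s t0s st => /eqP; rewrite addrC addr_eq0 => /eqP ->.
  rewrite normrN mulrDl; apply: (le_trans (ler_normD _ _)); apply: lerD.
    rewrite !normrM (ger0_norm (powR_ge0 _ _)) mulrCA -!mulrA ler_wpM2l//.
    apply: (@le_trans _ _ ((t1 - s) `^ (1 - a) * (C * (t1 - s) `^ (a + b - 1)))).
      by rewrite ler_wpM2l ?powR_ge0// HC.
    rewrite mulrCA ler_wpM2l//.
    have -> : (t1 - s) `^ (1 - a) * (t1 - s) `^ (a + b - 1) = (t1 - s) `^ a * (t1 - s) `^ (b - a).
      by rewrite -!powRD ?u0 ?implybT//; congr (_ `^ _); ring.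
    rewrite ler_wpM2r ?powR_ge0//; apply: ge0_ler_powR.
    - exact: ltW.
    - by rewrite nnegrE subr_ge0 ltW.
    - by rewrite nnegrE subr_ge0 ltW.
    - by rewrite lerD2l lerN2.
  rewrite normrM (ger0_norm (powR_ge0 _ _)) mulrC ler_wpM2r ?powR_ge0//.
  exact: hM.
split=> // t; rewrite in_itv /= => /andP[t0t]; rewrite le_eqVlt => /predU1P[->|tt1].
  by rewrite /Ir Iright_end !mulr0 add0r subrr powR0 ?mul0r// subr_eq0 gt_eqF.
by have := EL t t0t tt1; rewrite D0 mulr0 addr0.
Qed.

End ScalarConditions.

(** * Admissible variations along a coordinate and their size *)

Section AdmissibleVariations.
Context {R : realType} {n : nat}.
Local Notation mu := (@lebesgue_measure R).
Variables (t0 t1 a : R).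
Hypotheses (t01 : t0 < t1) (a0 : 0 < a) (a1 : a <= 1).
Local Notation I := (`[t0, t1]%classic).
Implicit Types (phi psi : R -> 'rV[R]_n) (g : R -> R).

Lemma within_continuous_rV psi : (forall i, {within I, continuous (fun t => psi t 0 i)}) ->
  {within I, continuous psi}.
Proof.
move=> cpsi; apply/subspace_continuousP => t tI; apply/cvg_ballP => e e0.
have H (j : 'I_n) : \forall s \near within I (nbhs t), ball (psi t 0 j) e (psi s 0 j).
  by have /subspace_continuousP/(_ t tI)/cvg_ballP/(_ _ e0) := cpsi j.
have FF : Filter (within I (nbhs t)) by exact: within_filter.
have H' : within I (nbhs t) (fun s => forall j, ball (psi t 0 j) e (psi s 0 j)).
  exact: (@filter_forall _ _ (fun j s => ball (psi t 0 j) e (psi s 0 j)) _ FF H).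
have : within I (nbhs t) (fun s => ball (psi t) e (psi s)); last by [].
apply: filterS H' => s hs; split => // i j.
by rewrite (ord1 i); exact: hs.
Qed.

(** Along a coordinate axis the Euclidean norm in [Calpha_norm] is an absolute value, which makes
    the norm of a variation explicit. *)
Lemma enorm_delta (s : R) (i : 'I_n) : enorm (s *: delta_mx 0 i) = `|s|.
Proof.
rewrite /enorm (bigD1 i)//= !mxE !eqxx /= mulr1 big1 ?addr0 ?sqrtr_sqr// => k ki.
by rewrite !mxE (negbTE ki) andbF mulr0 expr0n.
Qed.

Lemma RLleft_variation psi g c i t : {within I, continuous psi} ->
  {within I, continuous g} -> t \in `[t0, t1] ->
  RLleft t0 a (fun s => psi s + (c * g s) *: delta_mx 0 i) t =
  RLleft t0 a psi t + (c * ((Gamma a)^-1 * Ileft t0 t1 a g t)) *: delta_mx 0 i.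
Proof.
move=> cpsi cg tI; apply/rowP => k; rewrite mxE.
have ck : {within I, continuous (fun s => psi s 0 k)} by exact: within_continuous_coord.
have E : (fun s => (psi s + (c * g s) *: delta_mx 0 i) 0 k) =
    (fun s => psi s 0 k + (c * (k == i)%:R) * g s).
  by apply/funext => s; rewrite !mxE eqxx /=; ring.
have cE : {within I, continuous (fun s => psi s 0 k + (c * (k == i)%:R) * g s)}.
  move=> s; apply: cvgD; first exact: ck.
  by apply: cvgM; [exact: cvg_cst|exact: cg].
have an0 : a != 0 by rewrite gt_eqF.
rewrite !(RLleft_coord an0 tI); last 2 first.
- exact: measurable_continuous_itv.
- by rewrite E; exact: measurable_continuous_itv.
rewrite E IleftDZ// !mxE eqxx /=; ring.
Qed.

Lemma RLleft0 t : RLleft t0 a (fun=> 0 : 'rV[R]_n) t = 0.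
Proof.
apply/rowP => k; rewrite /RLleft gt_eqF// !mxE.
rewrite (@eq_Rintegral _ _ _ _ _ (cst 0)); last by move=> s _; rewrite !mxE mulr0.
by rewrite /Rintegral integral0 mulr0.
Qed.

Lemma continuous_RLleft phi psi : {within I, continuous psi} ->
  {in `[t0, t1], forall t, phi t = phi t0 + RLleft t0 a psi t} ->
  {within I, continuous phi}.
Proof.
move=> cpsi phiE; apply: within_continuous_rV => i.
have ci : {within I, continuous (fun s => psi s 0 i)} by exact: within_continuous_coord.
have [M M0 fM] := continuous_bounded_itv ci.
have mi := measurable_continuous_itv ci.
apply: (@subspace_eq_continuous _ _ _
  (fun t => phi t0 0 i + (Gamma a)^-1 * Ileft t0 t1 a (fun s => psi s 0 i) t)).
  move=> t /set_mem tI; rewrite -[RHS]/(phi t 0 i) (phiE t tI) mxE (RLleft_coord _ tI)//.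
  by rewrite gt_eqF.
apply: continuous_subspaceT => t; apply: cvgD; first exact: cvg_cst.
apply: cvgM; first exact: cvg_cst.
exact: (Ileft_continuous a0 a1 (ltW M0) mi fM).
Qed.

Section Direction.
Variables (psi : R -> 'rV[R]_n) (xm : R -> 'rV[R]_n) (g : R -> R) (i : 'I_n).
Hypotheses (cpsi : {within I, continuous psi}) (cg : {within I, continuous g}).
Hypothesis xmE : {in `[t0, t1], forall t, xm t = xm t0 + RLleft t0 a psi t}.
Let eta t := (Gamma a)^-1 * Ileft t0 t1 a g t.
Let xe (eps t : R) : 'rV[R]_n := xm t + (eps * eta t) *: delta_mx 0 i.

Lemma eta_start : eta t0 = 0.
Proof. by rewrite /eta Ileft_start mulr0. Qed.

Lemma continuous_variation psi' eps : {within I, continuous psi'} ->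
  {within I, continuous (fun t => psi' t + (eps * g t) *: delta_mx 0 i)}.
Proof.
by move=> c'; apply: within_continuousD => //; exact: within_continuousZ.
Qed.

Lemma variation_start eps : xe eps t0 = xm t0.
Proof. by rewrite /xe eta_start mulr0 scale0r addr0. Qed.

Lemma variationE eps : {in `[t0, t1], forall t,
  xe eps t = xe eps t0 + RLleft t0 a (fun t => psi t + (eps * g t) *: delta_mx 0 i) t}.
Proof.
by move=> t tI; rewrite variation_start RLleft_variation// /xe xmE// addrA.
Qed.

Lemma Calpha_variation eps : Calpha t0 t1 a (xe eps).
Proof.
exists (fun t => psi t + (eps * g t) *: delta_mx 0 i); split; first exact: continuous_variation.
exact: variationE.
Qed.

Lemma caputo_variation eps t : t \in `[t0, t1] ->
  caputo t0 t1 a (xe eps) t = psi t + (eps * g t) *: delta_mx 0 i.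
Proof.
move=> tI.
apply: (@caputo_RLleft _ _ _ _ t01 a (xe eps)
  (fun t => psi t + (eps * g t) *: delta_mx 0 i) t a0 a1 _ _ tI).
  exact: continuous_variation.
exact: variationE.
Qed.

(** The variation is eps eta and its Caputo derivative eps g, so bounds of eta and of g add up to
    the constant. Small eps thus stays inside the weak neighbourhood. *)
Lemma Calpha_norm_variation : exists2 C, 0 < C & forall eps,
  Calpha_norm t0 t1 a (fun t => xe eps t - xm t) <= C * `|eps|.
Proof.
have [N N0 gN] := continuous_bounded_itv cg.
have ce : {within I, continuous eta}.
  apply: continuous_subspaceT => t; apply: cvgM; first exact: cvg_cst.
  exact: (Ileft_continuous a0 a1 (ltW N0) (measurable_continuous_itv cg) gN).
have [M M0 eM] := continuous_bounded_itv ce.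
exists (M + N); first exact: addr_gt0.
move=> eps; rewrite mulrDl.
have dE t : xe eps t - xm t = (eps * eta t) *: delta_mx 0 i by rewrite /xe addrC addKr.
rewrite /Calpha_norm (funext dE); apply: lerD; apply: ge_sup.
- by eexists; exists t0 => //=; rewrite in_itv /= lexx ltW.
- move=> _ [t tI <-]; rewrite ?dE enorm_delta normrM mulrC ler_wpM2r//; exact: eM.
- by eexists; exists t0 => //=; rewrite in_itv /= lexx ltW.
move=> _ [t tI <-].
have -> : caputo t0 t1 a (fun t => (eps * eta t) *: delta_mx 0 i) t = (eps * g t) *: delta_mx 0 i.
  apply: (@caputo_RLleft _ _ _ _ t01 a (fun t => (eps * eta t) *: delta_mx 0 i)
    (fun t => (eps * g t) *: delta_mx 0 i) t a0 a1) => //.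
    exact: within_continuousZ.
  move=> s sI; rewrite eta_start mulr0 scale0r add0r.
  (* Read as a variation of the zero function, whose fractional integral is 0. *)
  have E : (fun t => (eps * g t) *: delta_mx 0 i) =
      (fun t => 0 + (eps * g t) *: delta_mx 0 i) :> (R -> 'rV[R]_n).
    by apply/funext => u; rewrite add0r.
  rewrite E RLleft_variation ?RLleft0 ?add0r//.
  by apply: continuous_subspaceT => u; exact: cvg_cst.
by rewrite enorm_delta normrM mulrC ler_wpM2r//; exact: gN.
Qed.

End Direction.
End AdmissibleVariations.

(** Along xm + eps eta e_i the functional becomes a function of eps alone, minimal at 0 for |eps| <
    delta / C. The initial condition is kept because eta vanishes at t0. *)
Lemma weak_min_stationary (R : realType) (n : nat) (t0 t1 : R) (x0 : 'rV[R]_n)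
    (alpha beta : R) (L : R -> 'rV[R]_n -> 'rV[R]_n -> R) (l : 'rV[R]_n -> R)
    (xm psi : R -> 'rV[R]_n) (i : 'I_n) (g : R -> R) :
  t0 < t1 -> 0 < alpha -> alpha <= 1 -> 0 < beta ->
  weak_local_min t0 t1 alpha beta L l x0 xm ->
  {within `[t0, t1], continuous psi} ->
  {in `[t0, t1], forall t, xm t = xm t0 + RLleft t0 alpha psi t} ->
  C1_near_graph t0 t1 L xm psi ->
  derivable l (xm t1) (delta_mx 0 i) ->
  {within `[t0, t1], continuous g} ->
  \int[lebesgue_measure]_(t in `[t0, t1]) ((t1 - t) `^ (beta - 1) *
    ((Gamma alpha)^-1 * Ileft t0 t1 alpha g t * gradx L t (xm t) (psi t) 0 i
     + g t * grady L t (xm t) (psi t) 0 i))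
  + (Gamma alpha)^-1 * Ileft t0 t1 alpha g t1 * gradient l (xm t1) 0 i = 0.
Proof.
move=> t01 a0 a1 b0 [[_ xm0] [delta d0 Hmin]] cpsi xmE [U [oU Uxy grad [cL cLx cLy]]] dl cg.
pose eta t := (Gamma alpha)^-1 * Ileft t0 t1 alpha g t.
pose xe (eps t : R) : 'rV[R]_n := xm t + (eps * eta t) *: delta_mx 0 i.
have cx := continuous_RLleft a0 a1 cpsi xmE.
have [N N0 gN] := continuous_bounded_itv cg.
have ce : {within `[t0, t1], continuous eta}.
  apply: continuous_subspaceT => t; apply: cvgM; first exact: cvg_cst.
  exact: (Ileft_continuous a0 a1 (ltW N0) (measurable_continuous_itv cg) gN).
have JE eps : functional_J t0 t1 alpha beta L l (xe eps) =
    \int[lebesgue_measure]_(t in `[t0, t1]) ((t1 - t) `^ (beta - 1) *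
    L t (xm t + (eps * eta t) *: delta_mx 0 i) (psi t + (eps * g t) *: delta_mx 0 i)) +
    l (xm t1 + (eps * eta t1) *: delta_mx 0 i).
  rewrite /functional_J; congr (_ + _); apply: eq_Rintegral => t; rewrite inE => tI.
  by rewrite (caputo_variation t01 a0 a1 i cpsi cg xmE).
have [C C0 HC] := @Calpha_norm_variation R n t0 t1 alpha t01 a0 a1 xm g i cg.
have r0 : 0 < delta / C by exact: divr_gt0.
have := @first_variation R n t0 t1 beta t01 b0 L xm psi U oU Uxy cx cpsi grad cL cLx cLy
  i eta g ce cg l dl _ r0 _.
rewrite /gradient mxE; apply => eps eC.
rewrite -!JE; have -> : xe 0 = xm.
  by apply/funext => t; rewrite /xe mul0r scale0r addr0.
apply: Hmin.
  split; first exact: (Calpha_variation a0 i cpsi cg xmE).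
  by rewrite -xm0 /xe /eta Ileft_start !mulr0 scale0r addr0.
by apply: (le_lt_trans (HC eps)); rewrite mulrC -ltr_pdivlMr.
Qed.

Theorem theorem4p6 (R : realType) (n : nat) (t0 t1 : R) (x0 : 'rV[R]_n)
    (alpha beta : R) (L : R -> 'rV[R]_n -> 'rV[R]_n -> R) (l : 'rV[R]_n -> R)
    (xm : R -> 'rV[R]_n) :
  t0 < t1 -> 0 < alpha <= 1 -> 0 < beta ->
  weak_local_min t0 t1 alpha beta L l x0 xm ->
  C1_near_graph t0 t1 L xm (caputo t0 t1 alpha xm) ->
  C1_near l (xm t1) ->
  let Lx := fun t => gradx L t (xm t) (caputo t0 t1 alpha xm t) in
  let Ly := fun t => grady L t (xm t) (caputo t0 t1 alpha xm t) in
  let b := fun t => (t1 - t) `^ (beta - 1) *: Lx t in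
  let lx1 := gradient l (xm t1) in
  (0 < alpha < beta ->
     [/\ forall t, t \in `[t0, t1] ->
           (t1 - t) `^ (1 - alpha) *: RLright t1 alpha b t
             + (t1 - t) `^ (beta - alpha) *: Ly t = 0,
         xm t0 = x0 &
         lx1 = 0]) /\
  (0 < beta <= alpha ->
     (forall t, t \in `[t0, t1] ->
        (t1 - t) `^ (1 - beta) *: RLright t1 alpha b t
          + Ly t
          + ((t1 - t) `^ (alpha - beta) / Gamma alpha) *: lx1 = 0) /\
     xm t0 = x0).
Proof.
move=> t01 /andP[a0 a1] b0 wmin C1 Cl Lx Ly b lx1.
(* [psi] replaces the Caputo derivative throughout: its continuity on [t0, t1] is part of the
   definition of C^alpha, and the two agree on that interval. *)
have [[[psi [cpsi xmE]] xm0] _] := wmin.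
have capE t : t \in `[t0, t1] -> caputo t0 t1 alpha xm t = psi t.
  exact: caputo_RLleft.
have C1' : C1_near_graph t0 t1 L xm psi.
  have [U [oU Uxy grad cLL]] := C1; exists U; split => //.
  by move=> t tI; rewrite -capE//; exact: Uxy.
have cx := continuous_RLleft a0 a1 cpsi xmE.
have [U [oU Uxy grad [cL cLx cLy]]] := C1'.
have dl i : derivable l (xm t1) (delta_mx 0 i).
  by have [dl _] := nbhs_singleton Cl; exact: diff_derivable.
pose f i t := gradx L t (xm t) (psi t) 0 i.
pose h i t := grady L t (xm t) (psi t) 0 i.
have cf i : {within `[t0, t1], continuous (f i)}.
  apply: within_continuous_coord.
  exact: (within_comp_graph cLx cx cpsi Uxy).
have ch i : {within `[t0, t1], continuous (h i)}.
  apply: within_continuous_coord.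
  exact: (within_comp_graph cLy cx cpsi Uxy).
have stat i g := @weak_min_stationary R n t0 t1 x0 alpha beta L l xm psi i g
  t01 a0 a1 b0 wmin cpsi xmE C1' (dl i).
have G0 : (Gamma alpha)^-1 != 0 by rewrite invr_eq0 gt_eqF// Gamma_gt0.
have bE i : {in `[t0, t1], (fun t => b t 0 i) =1 (fun t => (t1 - t) `^ (beta - 1) * f i t)}.
  by move=> t tI; rewrite /b /Lx mxE capE.
have LyE i t : t \in `[t0, t1] -> Ly t 0 i = h i t by move=> tI; rewrite /Ly capE.
have RE i t : t \in `[t0, t1] -> RLright t1 alpha b t 0 i = (Gamma alpha)^-1 *
    Iright t0 t1 alpha (fun t => (t1 - t) `^ (beta - 1) * f i t) t.
  move=> tI; rewrite (@RLright_coord _ _ t0 t1)//; first by rewrite (eq_Iright _ _ (bE i)).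
  have mw : measurable_fun `[t0, t1] (fun t : R => (t1 - t) `^ (beta - 1) * f i t).
    apply: measurable_funM; last exact: measurable_continuous_itv.
    by apply: measurable_funTS; exact: measurable_weight.
  apply: eq_measurable_fun mw => s sI; rewrite -bE//.
  by move: sI; rewrite inE.
split.
- move=> /andP[_ ab].
  have H i := condition_alpha_lt_beta t01 a0 a1 b0 (cf i) (ch i) (stat i) ab G0.
  split => //.
  + move=> t tI; apply/rowP => i.
    have := (H i).2 t tI; rewrite -(LyE i t tI) -(RE i t tI).
    by move: (RLright t1 alpha b t) (Ly t) => r y; rewrite !mxE.
  + by apply/rowP => i; rewrite [RHS]mxE; exact: (H i).1.
- move=> /andP[_ ba]; split => // t tI; apply/rowP => i.
  have := condition_beta_le_alpha t01 a0 a1 b0 (cf i) (ch i) (stat i) ba tI.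
  rewrite -(LyE i t tI) -(RE i t tI) -[gradient l (xm t1)]/lx1.
  by move: (RLright t1 alpha b t) (Ly t) lx1 => r y z; rewrite !mxE.
Qed.
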